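(* Let $R>0$ be fixed, and let $V:\mathbb{R}\to\mathbb{R}$ be a smooth function for which there is a constant $c_V>0$ with \[ tV'(t)\ \ge\ -c_V^2 \quad\text{and}\quad V''(t)\ \ge\ -c_V^2 \qquad\text{for all } t\in\mathbb{R}. \] Then there exists $L_0>0$ such that for every $0<L<L_0$ the following holds: if $\phi\in L^2_{2,\text{boundary}-0}(X_L)$ satisfies \[ \Delta\phi - V'(\phi)=0 \quad\text{on } X_L, \] then $\phi$ is independent of the $z$-direction, i.e. $\partial_z\phi=0$.
   Context: For $L>0$, $S^1_L=[0,L]/\!\sim$ is the circle of length $L$ with coordinate $z$, and $X_L=B^2(R)\times S^1_L$, where $B^2(R)\subset\mathbb{R}^2$ is the open disc of radius $R$, with the flat product metric; points are written $(x,z)$. $\Delta$ is the Laplacian of this flat metric. For a Riemannian manifold $M$ (possibly with boundary), $L^p_k(M)$ is the completion of $C^\infty(M)$ with respect to the norm $\|f\|_{L^p_k}=\sum_{i=0}^k\|\nabla^i f\|_{L^p}$, and $L^p_{k,\text{boundary}-0}(M)$ is the completion of compactly supported smooth functions (in the interior) in this norm (functions vanishing on the boundary). *)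

(* Defs.v *)
From HB Require Import structures.
From mathcomp Require Import all_boot all_order all_algebra.
From mathcomp Require Import all_classical all_reals all_analysis.
Set Implicit Arguments. Unset Strict Implicit. Unset Printing Implicit Defensive.
Import Order.TTheory GRing.Theory Num.Theory.
Import numFieldNormedType.Exports.
Local Open Scope classical_set_scope.
Local Open Scope ring_scope.

Section Defs.
Variable R : realType.

(* Functions on R^3, coordinates (x1, x2, z), curried. *)
Definition fn3 := R -> R -> R -> R.

Definition unc (f : fn3) : (R * R) * R -> R := fun p => f p.1.1 p.1.2 p.2.

Definition pd (i : nat) (f : fn3) : fn3 :=
  match i with
  | 0 => fun a b c => derive1 (fun t => f t b c) a
  | 1 => fun a b c => derive1 (fun t => f a t c) b
  | _ => fun a b c => derive1 (fun t => f a b t) c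
  end.

Definition pd_exists (i : nat) (f : fn3) : Prop :=
  forall a b c : R,
  match i with
  | 0 => derivable (fun t => f t b c) a 1
  | 1 => derivable (fun t => f a t c) b 1
  | _ => derivable (fun t => f a b t) c 1
  end.

Fixpoint pds (s : seq nat) (f : fn3) : fn3 :=
  match s with
  | [::] => f
  | i :: s' => pd i (pds s' f)
  end.

Definition smooth3 (f : fn3) : Prop :=
  forall s : seq nat,
    continuous (unc (pds s f)) /\ (forall i, (i < 3)%N -> pd_exists i (pds s f)).

Definition lap (f : fn3) : fn3 :=
  fun a b c => pds [:: 0%N; 0%N] f a b c + pds [:: 1%N; 1%N] f a b c
               + pds [:: 2%N; 2%N] f a b c.

(* Smooth function on X_L = B^2(Rad) x S^1_L with compact support in the interior:
   an L-periodic (in z) smooth function on R^3 vanishing outside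
   {x1^2 + x2^2 <= r^2} for some r < Rad. *)
Definition test_fn (Rad L : R) (f : fn3) : Prop :=
  smooth3 f /\ (forall a b c, f a b (c + L) = f a b c) /\
  exists r : R, 0 < r /\ r < Rad /\
    forall a b c, r ^+ 2 < a ^+ 2 + b ^+ 2 -> f a b c = 0.

(* fundamental domain of X_L in R^3 *)
Definition XL (Rad L : R) : set ((R * R) * R) :=
  [set p | p.1.1 ^+ 2 + p.1.2 ^+ 2 < Rad ^+ 2 /\ 0 <= p.2 /\ p.2 < L].

Definition leb3 := ((@lebesgue_measure R \x @lebesgue_measure R) \x @lebesgue_measure R)%E.

Definition L2sq (Rad L : R) (g : fn3) : \bar R :=
  (\int[leb3]_(p in XL Rad L) ((unc g p) ^+ 2)%:E)%E.

Definition L2_cauchy (Rad L : R) (g : nat -> fn3) : Prop :=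
  forall e : R, 0 < e -> exists N : nat, forall m n : nat, (N <= m)%N -> (N <= n)%N ->
    (L2sq Rad L (fun a b c => (g m a b c - g n a b c)%R) < e%:E)%E.

Definition L2_conv (Rad L : R) (g : nat -> fn3) (h : fn3) : Prop :=
  forall e : R, 0 < e -> exists N : nat, forall n : nat, (N <= n)%N ->
    (L2sq Rad L (fun a b c => (g n a b c - h a b c)%R) < e%:E)%E.

(* f is an approximating sequence exhibiting phi as an element of
   L^2_{2,boundary-0}(X_L): test functions, Cauchy for the L^2_2 norm
   (all derivatives of order <= 2 Cauchy in L^2), converging to phi in L^2. *)
Definition H20_approx (Rad L : R) (phi : fn3) (f : nat -> fn3) : Prop :=
  (forall n, test_fn Rad L (f n)) /\
  (forall s : seq nat, (size s <= 2)%N -> L2_cauchy Rad L (fun n => pds s (f n))) /\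
  L2_conv Rad L f phi.

(* phi (a measurable representative) lies in L^2_{2,boundary-0}(X_L) *)
Definition in_H20 (Rad L : R) (phi : fn3) : Prop :=
  measurable_fun (XL Rad L) (unc phi) /\ exists f, H20_approx Rad L phi f.

Definition smooth1 (V : R -> R) : Prop :=
  forall (n : nat) (x : R), derivable (iter n (@derive1 R R) V) x 1.

End Defs.

(* Main.v *)
Require Import Defs.
From HB Require Import structures.
From mathcomp Require Import all_boot all_order all_algebra.
From mathcomp Require Import all_classical all_reals all_analysis.
From mathcomp Require Import measurable_realfun ring lra.
Set Implicit Arguments. Unset Strict Implicit. Unset Printing Implicit Defensive.
Import Order.TTheory GRing.Theory Num.Theory.
Import numFieldNormedType.Exports.
Local Open Scope classical_set_scope.
Local Open Scope ring_scope.

(* Take L < 1 / cV. For a function h on X_L put Dh(x, z, z') = h(x, z) - h(x, z')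
   on B^2 x S^1 x S^1. There w = D(phi) satisfies
   (Delta_x + d_z^2 + d_z'^2) w = D(V'(phi)), and D(V'(phi)) * w >= - cV^2 w^2
   because V'' >= - cV^2. Testing the equation with w gives
   int |d_z w|^2 + |d_z' w|^2 <= cV^2 int w^2, whereas w has Poincare constant
   proportional to L in the circle directions, so that d_z phi = 0. Since phi is
   only a limit, the argument is run on the approximating test functions g_n with
   Lap g_n -> V'(phi): every error is absorbed by Young's inequality, which
   yields for each small e > 0 the bound
   |d_z g_n|^2 <= 8 e |Lap g_n|^2 + C(e) (|Lap g_n - V'(phi)|^2 + |g_n - phi|^2).
   Another approximating sequence f_n is compared with g_n through
   |d_z u|^2 <= |u|^2 / e + e |d_z^2 u|^2 for u = f_n - g_n. *)

(** * Integration over products *)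

(** Comparing two values of phi on the same circle takes the place of differentiating the equation
    in z: V' enters only through its increments, so phi is handled as a measurable function and
    V'(phi) is never differentiated. The energy of w in the x-directions has a favourable sign and
    is dropped. The threshold 1 / cV leaves room for the errors. Write A for |d_z f|^2. Each of the
    two circle terms integrates to L A over the pairs, while |f(z) - f(z')|^2 is at most L times the
    integral of |d_z f|^2 over the circle, so that its integral over the pairs is at most L^3 A. Up
    to errors the inequality reads 2 L A <= cV^2 L^3 A, whereas cV^2 L^2 <= 1; half of this slack
    pays for Young's inequality. Convergence of the Laplacians to V'(phi) is given for one
    approximating sequence, but the conclusion concerns all of them. The energy argument therefore
    serves the given sequence alone, and the transfer to another one uses only that second
    z-derivatives stay bounded in L^2. *)

Section ProductSigmaFinite.
Context d1 d2 (T1 : measurableType d1) (T2 : measurableType d2) (R : realType).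
Variable m1 : {sigma_finite_measure set T1 -> \bar R}.
Variable m2 : {sigma_finite_measure set T2 -> \bar R}.

(** With nondecreasing exhaustions [F] and [G], a point of [F n] times [G k] already lies in the
    diagonal rectangle of index [maxn n k], so the diagonal rectangles exhaust the product. *)
Lemma product_measure_sigma_finite : sigma_finite setT (m1 \x m2)%E.
Proof.
have /sigma_finiteP[F [TF ndF Foo]] := sigma_finiteT m1.
have /sigma_finiteP[G [TG ndG Goo]] := sigma_finiteT m2.
exists (fun n => F n `*` G n) => [|k].
  rewrite -setXTT TF TG; apply/seteqP; split=> [[x y] [/= [n _ Fnx] [k _ Gky]]|
      [x y] [n _ [? ?]]].
    exists (maxn n k) => //; split.
    - by move: x Fnx; exact/subsetPset/ndF/leq_maxl.
    - by move: y Gky; exact/subsetPset/ndG/leq_maxr.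
  by split; exists n.
have [? ?] := Foo k; have [? ?] := Goo k.
split; first exact: measurableX.
by rewrite product_measure1E// lte_mul_pinfty// ge0_fin_numE.
Qed.

(* The canonical sigma-finite structure of the library on [m1 \x m2] requires
   subprobabilities; this alias carries the general one. *)
Definition prodm : set (T1 * T2) -> \bar R := (m1 \x m2)%E.

HB.instance Definition _ := Measure.on prodm.
HB.instance Definition _ := Measure_isSigmaFinite.Build _ _ _ prodm
  product_measure_sigma_finite.

End ProductSigmaFinite.

Lemma integral_le0 d (T : measurableType d) (R : realType)
    (mu : {measure set T -> \bar R}) (D : set T) (f : T -> \bar R) :
  (forall x, D x -> (f x <= 0)%E) -> (\int[mu]_(x in D) f x <= 0)%E.
Proof.
move=> f0; rewrite integralE [X in (X - _)%E]integral0_eq ?sub0e ?oppe_le0.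
  exact: integral_ge0.
by move=> x Dx; rewrite funeposE; apply/max_idPr; exact: f0.
Qed.

Section IteratedIntegrals.
Context d1 d2 (T1 : measurableType d1) (T2 : measurableType d2) (R : realType).
Variables (m1 : {sigma_finite_measure set T1 -> \bar R}).
Variables (m2 : {sigma_finite_measure set T2 -> \bar R}).
Variables (A : set T1) (B : set T2).
Hypotheses (mA : measurable A) (mB : measurable B).
Local Open Scope ereal_scope.

(** Cutting off by a rectangle is cutting off in one coordinate after the other; this carries the
    Fubini and Tonelli theorems from the whole product to [A] times [B]. *)
Lemma patch_setX (f : T1 * T2 -> \bar R) x y :
  (f \_ (A `*` B)) (x, y) = ((fun x => ((fun y => f (x, y)) \_ B) y) \_ A) x.
Proof.
rewrite !patchE; case: (boolP (x \in A)) => xA; case: (boolP (y \in B)) => yB.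
- by rewrite mem_set//; split; rewrite -in_setE.
- by rewrite memNset//= => -[_] /mem_set; rewrite /= (negbTE yB).
- by rewrite memNset//= => -[] /mem_set; rewrite /= (negbTE xA).
- by rewrite memNset//= => -[] /mem_set; rewrite /= (negbTE xA).
Qed.

Lemma fubini_F_patch (f : T1 * T2 -> \bar R) :
  fubini_F m2 (f \_ (A `*` B)) =
  (fun x => \int[m2]_(y in B) f (x, y)) \_ A.
Proof.
apply/funext => x; rewrite /fubini_F; under eq_integral do rewrite patch_setX.
rewrite patchE; case: ifPn => xA; last first.
  by rewrite integral0_eq// => y _; rewrite patchE (negbTE xA).
rewrite [RHS]integral_mkcond; apply: eq_integral => y _.
by rewrite patchE xA.
Qed.

Lemma fubini_G_patch (f : T1 * T2 -> \bar R) :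
  fubini_G m1 (f \_ (A `*` B)) =
  (fun y => \int[m1]_(x in A) f (x, y)) \_ B.
Proof.
apply/funext => y; rewrite /fubini_G; under eq_integral do rewrite patch_setX.
rewrite patchE; case: ifPn => yB; last first.
  rewrite integral0_eq// => x _; rewrite patchE; case: ifP => // _.
  by rewrite patchE (negbTE yB).
rewrite [RHS]integral_mkcond; apply: eq_integral => x _.
by rewrite !patchE yB.
Qed.

Let mAB : measurable (A `*` B).
Proof. exact: measurableX. Qed.

Section nonnegative.
Variable f : T1 * T2 -> \bar R.
Hypotheses (f0 : forall p, 0 <= f p) (mf : measurable_fun (A `*` B) f).

Let f'0 p : 0 <= (f \_ (A `*` B)) p.
Proof. by rewrite patchE; case: ifP. Qed.

Let mf' : measurable_fun setT (f \_ (A `*` B)).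
Proof. exact/(measurable_restrictT _ mAB). Qed.

Lemma tonelli1_on : \int[m1 \x m2]_(p in A `*` B) f p =
  \int[m1]_(x in A) \int[m2]_(y in B) f (x, y).
Proof.
by rewrite integral_mkcond fubini_tonelli1// fubini_F_patch -integral_mkcond.
Qed.

Lemma tonelli2_on : \int[m1 \x m2]_(p in A `*` B) f p =
  \int[m2]_(y in B) \int[m1]_(x in A) f (x, y).
Proof.
by rewrite integral_mkcond fubini_tonelli2// fubini_G_patch -integral_mkcond.
Qed.

Lemma measurable_tonelli1_on :
  measurable_fun A (fun x => \int[m2]_(y in B) f (x, y)).
Proof.
apply/(measurable_restrictT _ mA); rewrite -fubini_F_patch.
exact: measurable_fun_fubini_tonelli_F.
Qed.

End nonnegative.

Section signed.
Variable f : T1 * T2 -> \bar R.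
Hypothesis If : (m1 \x m2).-integrable (A `*` B) f.

Let If' : (m1 \x m2).-integrable setT (f \_ (A `*` B)).
Proof. by apply/integrable_restrict => //; rewrite setTI. Qed.

Lemma fubini1_on : \int[m1 \x m2]_(p in A `*` B) f p =
  \int[m1]_(x in A) \int[m2]_(y in B) f (x, y).
Proof.
by rewrite integral_mkcond -integral12_prod_meas1// fubini_F_patch
  -integral_mkcond.
Qed.

Lemma fubini2_on : \int[m1 \x m2]_(p in A `*` B) f p =
  \int[m2]_(y in B) \int[m1]_(x in A) f (x, y).
Proof.
by rewrite integral_mkcond -integral21_prod_meas1// fubini_G_patch
  -integral_mkcond.
Qed.

Lemma integrable_fubini1_on :
  m1.-integrable A (fun x => \int[m2]_(y in B) f (x, y)).
Proof.
rewrite -[A]setTI; apply/(integrable_restrict m1 mA measurableT).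
rewrite -fubini_F_patch; exact: integrable_fubini_F.
Qed.

Lemma le0_fubini1 : (forall x, A x -> \int[m2]_(y in B) f (x, y) <= 0) ->
  \int[m1 \x m2]_(p in A `*` B) f p <= 0.
Proof.
move=> h; rewrite fubini1_on; apply: integral_le0 => x Ax; exact: h.
Qed.

Lemma le0_fubini2 : (forall y, B y -> \int[m1]_(x in A) f (x, y) <= 0) ->
  \int[m1 \x m2]_(p in A `*` B) f p <= 0.
Proof.
move=> h; rewrite fubini2_on; apply: integral_le0 => x Ax; exact: h.
Qed.

End signed.
End IteratedIntegrals.

(** The second factors may differ: the Poincaré inequality compares the pairs of points over a point
    of the disc with the single circle over it. *)
Lemma le_fubini1 (d1 d2 d3 : measure_display) (T1 : measurableType d1)
    (T2 : measurableType d2) (T3 : measurableType d3) (R : realType)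
    (m1 : {sigma_finite_measure set T1 -> \bar R})
    (m2 : {sigma_finite_measure set T2 -> \bar R})
    (m3 : {sigma_finite_measure set T3 -> \bar R})
    (A : set T1) (B : set T2) (C : set T3)
    (f : T1 * T2 -> \bar R) (g : T1 * T3 -> \bar R) :
  measurable A -> measurable B -> measurable C ->
  (m1 \x m2)%E.-integrable (A `*` B) f ->
  (m1 \x m3)%E.-integrable (A `*` C) g ->
  (forall x, A x ->
    \int[m2]_(y in B) f (x, y) <= \int[m3]_(y in C) g (x, y))%E ->
  (\int[m1 \x m2]_(p in A `*` B) f p <= \int[m1 \x m3]_(p in A `*` C) g p)%E.
Proof.
move=> mA mB mC If Ig h; rewrite !fubini1_on//.
apply: le_integral => //; [exact: integrable_fubini1_on..|].
by move=> x /set_mem; exact: h.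
Qed.

(** * Functions of one of two points in the same fibre *)

Section PairedFibers.
Context d1 d2 (X : measurableType d1) (Z : measurableType d2) (R : realType).
Variables (m : {sigma_finite_measure set X -> \bar R}).
Variables (n : {sigma_finite_measure set Z -> \bar R}).
Variables (A : set X) (I : set Z) (h : X * Z -> \bar R).
Hypotheses (mA : measurable A) (mI : measurable I).
Hypotheses (h0 : forall p, (0 <= h p)%E) (mh : measurable_fun (A `*` I) h).
Local Open Scope ereal_scope.

Let measurable_fiber x : A x -> measurable_fun I (fun z => h (x, z)).
Proof.
move=> Ax; apply: (@measurable_comp _ _ _ _ _ _ (A `*` I) h I (fun z => (x, z))).
- exact: measurableX.
- by move=> _ [z Iz <-].
- exact: mh.
- by apply: measurable_funTS; exact: measurable_pair1.
Qed.

Let iterated : \int[m]_(x in A) (\int[n]_(z in I) h (x, z) * n I) =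
  \int[m \x n]_(p in A `*` I) h p * n I.
Proof.
rewrite ge0_integralZr//; first by rewrite tonelli1_on.
- exact: measurable_tonelli1_on.
- by move=> x _; exact: integral_ge0.
Qed.

Lemma measurable_pair_fst :
  measurable_fun (A `*` (I `*` I)) (fun p => h (p.1, p.2.1)).
Proof.
apply: (@measurable_comp _ _ _ _ _ _ (A `*` I) h _ (fun p => (p.1, p.2.1))).
- exact: measurableX.
- by move=> _ [[x [z z']] /= [Ax [Iz _]] <-].
- exact: mh.
- apply: measurable_funTS; apply: measurable_fun_pair => //.
  exact: measurableT_comp.
Qed.

Lemma measurable_pair_snd :
  measurable_fun (A `*` (I `*` I)) (fun p => h (p.1, p.2.2)).
Proof.
apply: (@measurable_comp _ _ _ _ _ _ (A `*` I) h _ (fun p => (p.1, p.2.2))).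
- exact: measurableX.
- by move=> _ [[x [z z']] /= [Ax [_ Iz]] <-].
- exact: mh.
- apply: measurable_funTS; apply: measurable_fun_pair => //.
  exact: measurableT_comp.
Qed.

(** Tonelli: the other point of the pair is free and contributes the factor [n I], which becomes [L]
    for the circle. *)
Lemma integral_pair_fst :
  \int[m \x prodm n n]_(p in A `*` (I `*` I)) h (p.1, p.2.1) =
  \int[m \x n]_(p in A `*` I) h p * n I.
Proof.
rewrite -iterated tonelli1_on//; [|exact: measurableX|exact: measurable_pair_fst].
apply: eq_integral => x /set_mem Ax /=.
rewrite (@tonelli1_on _ _ _ _ _ n n I I mI mI (fun q => h (x, q.1)))//.
  rewrite -ge0_integralZr//; last exact: measurable_fiber.
  by apply: eq_integral => z _; exact: (integral_cst n mI (h (x, z))).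
apply: (@measurable_comp _ _ _ _ _ _ I (fun z => h (x, z)) _ fst) => //.
- by move=> _ [[z z'] [/= Iz _] <-].
- exact: measurable_fiber.
- exact: measurable_funTS.
Qed.

Lemma integral_pair_snd :
  \int[m \x prodm n n]_(p in A `*` (I `*` I)) h (p.1, p.2.2) =
  \int[m \x n]_(p in A `*` I) h p * n I.
Proof.
rewrite -iterated tonelli1_on//; [|exact: measurableX|exact: measurable_pair_snd].
apply: eq_integral => x /set_mem Ax /=.
rewrite (@tonelli2_on _ _ _ _ _ n n I I mI mI (fun q => h (x, q.2)))//.
  rewrite -ge0_integralZr//; last exact: measurable_fiber.
  by apply: eq_integral => z _; exact: (integral_cst n mI (h (x, z))).
apply: (@measurable_comp _ _ _ _ _ _ I (fun z => h (x, z)) _ snd) => //.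
- by move=> _ [[z z'] [/= _ Iz] <-].
- exact: measurable_fiber.
- exact: measurable_funTS.
Qed.

End PairedFibers.

(** Rounding the second variable down to a multiple of [1 / (n + 1)] gives functions whose preimages
    are countable unions of measurable rectangles. They converge pointwise because [f x] is
    continuous. *)
Lemma measurable_caratheodory d (T : measurableType d) (R : realType)
    (f : T -> R -> R) :
  (forall x, continuous (f x)) -> (forall y, measurable_fun setT (f^~ y)) ->
  measurable_fun setT (fun p : T * R => f p.1 p.2).
Proof.
move=> cf mf.
pose r n (y : R) : R := (Num.floor (n.+1%:R * y))%:~R / n.+1%:R.
apply: (@measurable_fun_cvg _ _ _ _ (fun n p => f p.1 (r n p.2))) => [n|[x y] _].
  move=> _ Y mY; rewrite setTI.
  have -> : (fun p : T * R => f p.1 (r n p.2)) @^-1` Y = \bigcup_(k in [set: int])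
      (((f^~ (k%:~R / n.+1%:R)) @^-1` Y) `*`
       `[k%:~R / n.+1%:R, (k + 1)%:~R / n.+1%:R[%classic).
    apply/seteqP; split=> [[x y] /= h|[x y] [k _] /= [h]].
      exists (Num.floor (n.+1%:R * y)) => //=; split => //.
      rewrite in_itv/= ler_pdivrMr// ltr_pdivlMr// mulrC.
      by rewrite floor_le floorD1_gt.
    rewrite in_itv/= ler_pdivrMr// ltr_pdivlMr// mulrC => kn.
    by rewrite /r (floor_def kn).
  apply: countable_bigcupT_measurable => [|k]; first exact: countableP.
  apply: measurableX => //; rewrite -[X in measurable X]setTI; exact: mf.
apply: (cvg_comp _ (f x)); last exact: cf.
apply/cvgrPdist_lt => e e0; near=> n.
rewrite distrC ltr_norml; have n0 : 0 < n.+1%:R :> R by [].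
have h1 := floor_le (n.+1%:R * y); have h2 := floorD1_gt (n.+1%:R * y).
have ne : n.+1%:R^-1 < e by near: n; exact: near_infty_natSinv_lt (PosNum e0).
rewrite ltrBrDr ltrBlDr /r ltr_pdivlMr// ltr_pdivrMr//.
have : n.+1%:R * e > 1 by rewrite -ltr_pdivrMl// mulr1.
move: h1 h2; rewrite intrD mulr1z mulrC /=.
set z := _%:~R; set N := n.+1%:R => h1 h2 h3; rewrite !mulrDl mulNr.
apply/andP; split; lra.
Unshelve. all: by end_near. Qed.

(** Continuity refers to the product topology, measurability to the product sigma-algebra; the
    Carathéodory criterion bridges the two, one variable at a time. *)
Lemma measurable_continuous3 (R : realType) (f : R -> R -> R -> R) :
  continuous (fun p : (R * R) * R => f p.1.1 p.1.2 p.2) ->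
  measurable_fun setT (fun p : (R * R) * R => f p.1.1 p.1.2 p.2).
Proof.
move=> cf.
apply: (@measurable_caratheodory _ (R * R)%type R (fun q z => f q.1 q.2 z)) => [[a b]|c] /=.
  move=> c; apply: (continuous_comp (f := fun c => ((a, b), c))
    (g := fun p => f p.1.1 p.1.2 p.2)); last exact: cf.
  exact: cvg_pair (cvg_cst _) cvg_id.
apply: (@measurable_caratheodory _ R R (fun a b => f a b c)) => [a b|b].
  apply: (continuous_comp (f := fun b => ((a, b), c))
    (g := fun p => f p.1.1 p.1.2 p.2)); last exact: cf.
  exact: cvg_pair (cvg_pair (cvg_cst _) cvg_id) (cvg_cst _).
apply: continuous_measurable_fun => a.
apply: (continuous_comp (f := fun a => ((a, b), c))
  (g := fun p => f p.1.1 p.1.2 p.2)); last exact: cf.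
exact: cvg_pair (cvg_pair cvg_id (cvg_cst _)) (cvg_cst _).
Qed.

(** * One-dimensional identities *)

Section OneVariable.
Context {R : realType}.
Notation leb := (@lebesgue_measure R).
Implicit Types (u F f : R -> R) (a b : R).

Lemma is_derive1_continuous F f :
  (forall t : R, is_derive t 1 F (f t)) -> continuous F.
Proof.
by move=> dF t; apply/differentiable_continuous/derivable1_diffP.
Qed.

Lemma continuous_integrable_cc f a b : continuous f ->
  leb.-integrable `[a, b] (EFin \o f).
Proof.
move=> cf; apply: continuous_compact_integrable; first exact: segment_compact.
exact: continuous_subspaceT.
Qed.

Lemma integral_is_derive F f a b : a < b ->
  (forall t : R, is_derive t 1 F (f t)) -> continuous f ->
  (\int[leb]_(t in `[a, b]) (f t)%:E = (F b - F a)%:E)%E.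
Proof.
move=> ab dF cf; have cF := is_derive1_continuous dF.
rewrite (@continuous_FTC2 _ f F)//.
- exact: continuous_subspaceT.
- split=> [t _||]; first by [].
  + by apply: cvg_at_right_filter; exact: cF.
  + by apply: cvg_at_left_filter; exact: cF.
- by move=> t _; rewrite derive1E derive_val.
Qed.

Lemma integral_bndo_bndc_continuous f a b : continuous f ->
  (\int[leb]_(t in `[a, b[) (f t)%:E = \int[leb]_(t in `[a, b]) (f t)%:E)%E.
Proof.
move=> cf; apply: integral_itv_bndo_bndc; apply/measurable_EFinP.
by apply: measurable_funTS; exact: continuous_measurable_fun.
Qed.

Variables (u u1 u2 : R -> R).
Hypotheses (du : forall t : R, is_derive t 1 u (u1 t))
  (du1 : forall t : R, is_derive t 1 u1 (u2 t)) (cu2 : continuous u2).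

Let cu : continuous u := is_derive1_continuous du.
Let cu1 : continuous u1 := is_derive1_continuous du1.

(** The constant [c] stands for the value at the other point of a pair, frozen while one integrates
    along one circle. *)
Lemma is_derive_mul_sub (c t : R) :
  is_derive t 1 (fun t => u1 t * (u t - c)) (u2 t * (u t - c) + u1 t ^+ 2).
Proof.
have d : is_derive t 1 (fun t => u t - c) (u1 t).
  have h := @is_deriveB R R R u (cst c) t 1 _ _ (du t) (is_derive_cst c t 1).
  by apply: (is_derive_eq h); rewrite subr0.
have h := @is_deriveM R R u1 (fun t => u t - c) t 1 _ _ (du1 t) d.
apply: (is_derive_eq h).
by rewrite /GRing.scale/= addrC expr2 [X in X + _]mulrC.
Qed.

Let continuous_energy c : continuous (fun t => u2 t * (u t - c) + u1 t ^+ 2).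
Proof.
move=> t; apply: cvgD; last by apply: cvgM; exact: cu1.
by apply: cvgM; [exact: cu2|apply: cvgB; [exact: cu|exact: cvg_cst]].
Qed.

(** Integration by parts: the boundary terms vanish and minus the integral of [u1 ^+ 2] remains. *)
Lemma integral_dirichlet_le0 a b : a < b -> u a = 0 -> u b = 0 ->
  (\int[leb]_(t in `[a, b]) (u2 t * u t)%:E <= 0)%E.
Proof.
move=> ab ua ub.
have <- : (\int[leb]_(t in `[a, b]) (u2 t * (u t - 0) + u1 t ^+ 2)%:E = 0)%E.
  rewrite (integral_is_derive ab (is_derive_mul_sub 0))//.
  by rewrite ua ub !subr0 !mulr0 subr0.
apply: le_integral => //.
- apply: continuous_integrable_cc => t.
  by apply: cvgM; [exact: cu2|exact: cu].
- exact: continuous_integrable_cc.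
- by move=> t _; rewrite lee_fin subr0 lerDl sqr_ge0.
Qed.

Lemma integral_periodic_eq0 a b c : a < b -> u a = u b -> u1 a = u1 b ->
  (\int[leb]_(t in `[a, b[) (u2 t * (u t - c) + u1 t ^+ 2)%:E = 0)%E.
Proof.
move=> ab uab u1ab; rewrite integral_bndo_bndc_continuous//.
by rewrite (integral_is_derive ab (is_derive_mul_sub c))// uab u1ab subrr.
Qed.

Let continuous_sqr1 : continuous (fun t => u1 t ^+ 2).
Proof. by move=> t; apply: cvgM; exact: cu1. Qed.

(** This is the pointwise form of the Poincaré inequality: for a difference of two values no mean
    has to be subtracted, and Cauchy-Schwarz between the two points suffices. *)
Lemma sqr_sub_le_integral a b s t : a <= s -> s <= t -> t <= b ->
  (((u t - u s) ^+ 2)%:E <= (b - a)%:E * \int[leb]_(t in `[a, b[) (u1 t ^+ 2)%:E)%E.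
Proof.
move=> as_ st tb; have ab : a <= b by lra.
have I0 : (0 <= \int[leb]_(t in `[a, b[) (u1 t ^+ 2)%:E)%E.
  by apply: integral_ge0 => x _; rewrite lee_fin sqr_ge0.
move: st; rewrite le_eqVlt => /predU1P[->|st].
  by rewrite subrr expr0n/= mule_ge0// lee_fin subr_ge0.
pose m := (u t - u s) / (t - s).
(* Cauchy-Schwarz on [s, t]: u'^2 >= 2 m u' - m^2 with m the mean slope *)
have h : (((u t - u s) ^+ 2 / (t - s))%:E <=
    \int[leb]_(t in `[a, b[) (u1 t ^+ 2)%:E)%E.
  have dF (x : R) : is_derive x 1 (fun x => 2 * m * u x - m ^+ 2 * x)
      (2 * m * u1 x - m ^+ 2).
    have h1 := @is_deriveZ R R R u (2 * m) x 1 _ (du x).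
    have h2 := @is_deriveZ R R R id (m ^+ 2) x 1 _ (is_derive_id x 1).
    by apply: (is_derive_eq (is_deriveB h1 h2)); rewrite /GRing.scale/= mulr1.
  have cf : continuous (fun x => 2 * m * u1 x - m ^+ 2).
    move=> x; apply: cvgB; last exact: cvg_cst.
    by apply: cvgM; [exact: cvg_cst|exact: cu1].
  have e := integral_is_derive st dF cf.
  apply: (@le_trans _ _ (\int[leb]_(t in `[s, t]) (u1 t ^+ 2)%:E)%E).
    suff -> : (u t - u s) ^+ 2 / (t - s) =
        2 * m * u t - m ^+ 2 * t - (2 * m * u s - m ^+ 2 * s).
      rewrite -e; apply: le_integral => //; try exact: continuous_integrable_cc.
      by move=> x _; rewrite lee_fin -subr_ge0 (_ : _ - _ = (u1 x - m) ^+ 2) ?sqr_ge0//; ring.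
    by rewrite /m; field; lra.
  rewrite integral_bndo_bndc_continuous//; apply: ge0_subset_integral => //.
  - apply/measurable_EFinP; apply: measurable_funTS.
    apply: continuous_measurable_fun; exact: continuous_sqr1.
  - by move=> x _; rewrite lee_fin sqr_ge0.
  - by apply: subset_itvScc; rewrite bnd_simp.
have -> : (u t - u s) ^+ 2 = (t - s) * ((u t - u s) ^+ 2 / (t - s)).
  by field; lra.
rewrite EFinM; apply: lee_pmul => //; rewrite lee_fin; last lra.
- by rewrite subr_ge0 ltW.
- by rewrite divr_ge0 ?sqr_ge0// subr_ge0 ltW.
Qed.
End OneVariable.

(** * Smooth functions and pairs of points over the disc *)

Section BoundedMeasurable.
Context d (T : measurableType d) (R : realType).
Implicit Types (D : set T) (f g : T -> R).

(** A class closed under sums and products and integrable on sets of finite measure, so that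
    integrability of the polynomial expressions below follows from their shape. *)
Definition bmeas D f :=
  measurable_fun D f /\ exists M : R, forall x, D x -> `|f x| <= M.

Lemma bmeas_cst D (c : R) : bmeas D (fun=> c).
Proof. by split; [exact: measurable_cst|exists `|c|]. Qed.

Lemma bmeasD D f g : bmeas D f -> bmeas D g -> bmeas D (fun x => f x + g x).
Proof.
move=> [mf [M hM]] [mg [N hN]]; split; first exact: measurable_funD.
exists (M + N) => x Dx; apply: le_trans (ler_normD _ _) _.
by apply: lerD; [exact: hM|exact: hN].
Qed.

Lemma bmeasM D f g : bmeas D f -> bmeas D g -> bmeas D (fun x => f x * g x).
Proof.
move=> [mf [M hM]] [mg [N hN]]; split; first exact: measurable_funM.
by exists (M * N) => x Dx; rewrite normrM ler_pM// ?hM ?hN.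
Qed.

Lemma bmeasB D f g : bmeas D f -> bmeas D g -> bmeas D (fun x => f x - g x).
Proof.
move=> [mf [M hM]] [mg [N hN]]; split; first exact: measurable_funB.
exists (M + N) => x Dx; apply: le_trans (ler_normB _ _) _.
by apply: lerD; [exact: hM|exact: hN].
Qed.

Lemma bmeas_sqr D f : bmeas D f -> bmeas D (fun x => f x ^+ 2).
Proof. by move=> h; exact: bmeasM. Qed.

Lemma bmeas_integrable (mu : {measure set T -> \bar R}) D f :
  measurable D -> (mu D < +oo)%E -> bmeas D f ->
  mu.-integrable D (EFin \o f).
Proof.
move=> mD Dfin [mf [M hM]]; apply: measurable_bounded_integrable => //.
exists M; split; first exact: num_real.
by move=> N MN x Dx; apply: (le_trans (hM _ Dx)); exact: ltW.
Qed.

End BoundedMeasurable.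

Lemma bmeas_comp d d' (T : measurableType d) (T' : measurableType d')
    (R : realType) (D : set T) (D' : set T') (f : T' -> R) (g : T -> T') :
  measurable D' -> (forall x, D x -> D' (g x)) -> measurable_fun D g ->
  bmeas D' f -> bmeas D (f \o g).
Proof.
move=> mD' gD mg [mf [M hM]]; split.
  by apply: measurable_comp mf mg => // _ [x Dx <-]; exact: gD.
by exists M => x Dx; apply: hM; exact: gD.
Qed.

Section SmoothFields.
Context {R : realType}.
Implicit Types (f : fn3 R) (s : seq nat).

Lemma smooth3_measurable f s : smooth3 f -> measurable_fun setT (unc (pds s f)).
Proof. by move=> /(_ s)[cf _]; exact: measurable_continuous3. Qed.

Lemma smooth3_is_derive0 f s (a b c : R) : smooth3 f ->
  is_derive a 1 (fun t => pds s f t b c) (pds (0%N :: s) f a b c).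
Proof.
move=> /(_ s)[_ /(_ 0%N isT) h]; apply: DeriveDef; first exact: h.
by rewrite /= derive1E.
Qed.

Lemma smooth3_is_derive1 f s (a b c : R) : smooth3 f ->
  is_derive b 1 (fun t => pds s f a t c) (pds (1%N :: s) f a b c).
Proof.
move=> /(_ s)[_ /(_ 1%N isT) h]; apply: DeriveDef; first exact: h.
by rewrite /= derive1E.
Qed.

Lemma smooth3_is_derive2 f s (a b c : R) : smooth3 f ->
  is_derive c 1 (fun t => pds s f a b t) (pds (2%N :: s) f a b c).
Proof.
move=> /(_ s)[_ /(_ 2%N isT) h]; apply: DeriveDef; first exact: h.
by rewrite /= derive1E.
Qed.

Lemma smooth3_continuous0 f s (b c : R) : smooth3 f ->
  continuous (fun t => pds s f t b c).
Proof.
by move=> sf; apply: is_derive1_continuous => t; exact: smooth3_is_derive0.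
Qed.

Lemma smooth3_continuous1 f s (a c : R) : smooth3 f ->
  continuous (fun t => pds s f a t c).
Proof.
by move=> sf; apply: is_derive1_continuous => t; exact: smooth3_is_derive1.
Qed.

Lemma smooth3_continuous2 f s (a b : R) : smooth3 f ->
  continuous (fun t => pds s f a b t).
Proof.
by move=> sf; apply: is_derive1_continuous => t; exact: smooth3_is_derive2.
Qed.

Lemma periodic_derive_z f (L a b c : R) :
  smooth3 f -> (forall a b c, f a b (c + L) = f a b c) ->
  pds [:: 2%N] f a b (c + L) = pds [:: 2%N] f a b c.
Proof.
move=> sf pf.
have h1 := @smooth3_is_derive2 f [::] a b (c + L) sf.
have h2 := @smooth3_is_derive2 f [::] a b c sf.
have h3 : is_derive c 1 (fun t : R => t + L) (1 + 0).
  exact: (@is_deriveD R R R id (cst L) c 1 _ _ (is_derive_id c 1)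
    (is_derive_cst L c 1)).
have h4 := @is_derive1_comp R (fun t => f a b t) (fun t => t + L) c _ _ h1 h3.
have e : (fun t => f a b t) \o (fun t => t + L) = (fun t => f a b t).
  by apply/funext => t /=; rewrite pf.
rewrite e in h4; have := @derive_val _ _ _ _ _ _ _ h4.
by rewrite (@derive_val _ _ _ _ _ _ _ h2) addr0 mulr1 => ->.
Qed.

(** Closed and hence compact, in contrast to [XL]: smooth functions are bounded on it, and therefore
    on [XL] and along both projections of a pair. *)
Definition box (Rad L : R) : set ((R * R) * R) :=
  (`[- Rad, Rad] `*` `[- Rad, Rad]) `*` `[0, L].

Lemma smooth3_bounded f s (Rad L : R) : smooth3 f ->
  exists M : R, forall p, box Rad L p -> `|unc (pds s f) p| <= M.
Proof.
move=> /(_ s)[cf _].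
have cb : compact (unc (pds s f) @` box Rad L).
  apply: continuous_compact; first exact: continuous_subspaceT.
  by apply: compact_setX; [apply: compact_setX|]; exact: segment_compact.
have [M [_ hM]] := compact_bounded cb.
exists (M + 1) => p bp; apply: (hM (M + 1)); first by rewrite ltrDl.
by exists p.
Qed.

Lemma bmeas_smooth3 f s (Rad L : R) : smooth3 f ->
  bmeas (box Rad L) (unc (pds s f)).
Proof.
move=> sf; split; last exact: smooth3_bounded.
by apply: measurable_funTS; exact: smooth3_measurable.
Qed.

End SmoothFields.

(** * The space of pairs of points over the disc *)

Section PairDomain.
Context {R : realType}.
Variables Rad L : R.
Hypotheses (hRad : 0 < Rad) (hL : 0 < L).
Notation leb := (@lebesgue_measure R).
Notation leb2 := (prodm leb leb).
Notation leb3 := (leb2 \x leb)%E.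
Notation leb4 := (leb2 \x leb2)%E.

Definition disc : set (R * R) := [set q | q.1 ^+ 2 + q.2 ^+ 2 < Rad ^+ 2].
Definition period2 : set (R * R) := `[0, L[%classic `*` `[0, L[%classic.

(** Test functions vanish between the disc and this square, and on the square the two x-coordinates
    can be integrated separately over a fixed interval. *)
Definition square : set (R * R) := `[- Rad, Rad] `*` `[- Rad, Rad].

(* Pairs of points of X_L over the same point of the disc: ((x1, x2), (z, z')). *)
Definition pairs : set ((R * R) * (R * R)) := disc `*` period2.

Definition at_z (h : fn3 R) (p : (R * R) * (R * R)) : R :=
  h p.1.1 p.1.2 p.2.1.
Definition at_z' (h : fn3 R) (p : (R * R) * (R * R)) : R :=
  h p.1.1 p.1.2 p.2.2.
(** This is the operator D of the overview. *)
Definition gap (h : fn3 R) (p : (R * R) * (R * R)) : R := at_z h p - at_z' h p.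

Lemma XL_setX : XL Rad L = disc `*` `[0, L[.
Proof.
apply/seteqP; split=> [[[a b] c] /= [h [h1 h2]]|[[a b] c] /= [h]].
  by split=> //=; rewrite in_itv/= h1.
by rewrite in_itv/= => /andP[].
Qed.

Lemma measurable_disc : measurable disc.
Proof.
have -> : disc = setT `&` (fun q : R * R => q.1 ^+ 2 + q.2 ^+ 2) @^-1` `]-oo, Rad ^+ 2[.
  by apply/seteqP; split=> [q h|q [_]] /=; rewrite ?in_itv/=.
suff mf : measurable_fun setT (fun q : R * R => q.1 ^+ 2 + q.2 ^+ 2) by exact: mf.
by apply: measurable_funD; apply: measurable_funX.
Qed.

Lemma measurable_XL : measurable (XL Rad L).
Proof. by rewrite XL_setX; apply: measurableX => //; exact: measurable_disc. Qed.

Lemma measurable_period2 : measurable period2.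
Proof. exact: measurableX. Qed.

Lemma measurable_pairs : measurable pairs.
Proof.
by apply: measurableX; [exact: measurable_disc|exact: measurable_period2].
Qed.

Lemma disc_square q : disc q -> square q.
Proof.
case: q => a b; rewrite /disc /square /= !in_itv/= => h.
have sq x y : x ^+ 2 + y ^+ 2 < Rad ^+ 2 -> - Rad <= x <= Rad.
  move=> xy; rewrite -ler_norml -(@ler_pXn2r _ 2)// ?nnegrE ?(ltW hRad)//.
  by rewrite real_normK ?num_real// (le_trans _ (ltW xy))// lerDl sqr_ge0.
by split; apply: sq; [exact: h|rewrite addrC; exact: h].
Qed.

Lemma period_measure : leb `[0, L[ = L%:E.
Proof. by rewrite lebesgue_measure_itv/= lte_fin hL sube0. Qed.

Lemma square_finite : (leb2 square < +oo)%E.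
Proof.
rewrite /square /prodm product_measure1E//= lebesgue_measure_itv/= lte_fin.
by case: ifP => _; rewrite ?mule0// -EFinB -EFinM ltry.
Qed.

Lemma period2_measure : leb2 period2 = (L * L)%:E.
Proof.
rewrite /period2 /prodm product_measure1E// EFinM.
by congr (_ * _)%E; exact: period_measure.
Qed.

Lemma disc_finite : (leb2 disc < +oo)%E.
Proof.
apply: le_lt_trans square_finite; apply: le_measure; rewrite ?inE//.
- exact: measurable_disc.
- exact: measurableX.
- exact: disc_square.
Qed.

Lemma XL_finite : (leb3 (XL Rad L) < +oo)%E.
Proof.
rewrite XL_setX product_measure1E; [|exact: measurable_disc|by []].
apply: lte_mul_pinfty => //.
  by rewrite ge0_fin_numE//; exact: disc_finite.
by have := ltry L; rewrite -period_measure.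
Qed.

Lemma XL_box : XL Rad L `<=` box Rad L.
Proof.
rewrite XL_setX => -[q c] [/= /disc_square hq]; rewrite in_itv/= => /andP[c0 cL].
by split=> //=; rewrite in_itv/= c0 ltW.
Qed.

Lemma bmeas_XL (f : fn3 R) s : smooth3 f -> bmeas (XL Rad L) (unc (pds s f)).
Proof.
move=> sf; have [mf [M hM]] := bmeas_smooth3 s Rad L sf; split.
  by apply: measurable_funTS; exact: smooth3_measurable.
by exists M => p /XL_box; exact: hM.
Qed.

(** Integrability is established on this larger set of finite measure; it then serves both the disc
    and the square that replaces the disc in the x-integrations. *)
Definition square_pairs : set ((R * R) * (R * R)) :=
  square `*` period2.

Lemma bmeas_at_z (f : fn3 R) s : smooth3 f ->
  bmeas square_pairs (at_z (pds s f)).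
Proof.
move=> sf; apply: (@bmeas_comp _ _ _ _ _ _ (box Rad L) (unc (pds s f))
  (fun p => (p.1, p.2.1))).
- by apply: measurableX => //; exact: measurableX.
- move=> [q [z z']] [/= hq [/= hz hz']]; split => //=.
  by move: hz; rewrite !in_itv/= => /andP[-> /ltW].
- by apply: measurable_funTS; apply: measurable_fun_pair => //; apply: measurableT_comp.
- exact: bmeas_smooth3.
Qed.

Lemma bmeas_at_z' (f : fn3 R) s : smooth3 f ->
  bmeas square_pairs (at_z' (pds s f)).
Proof.
move=> sf; apply: (@bmeas_comp _ _ _ _ _ _ (box Rad L) (unc (pds s f))
  (fun p => (p.1, p.2.2))).
- by apply: measurableX => //; exact: measurableX.
- move=> [q [z z']] [/= hq [/= hz hz']]; split => //=.
  by move: hz'; rewrite !in_itv/= => /andP[-> /ltW].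
- by apply: measurable_funTS; apply: measurable_fun_pair => //; apply: measurableT_comp.
- exact: bmeas_smooth3.
Qed.

Lemma bmeas_gap (f : fn3 R) s : smooth3 f -> bmeas square_pairs (gap (pds s f)).
Proof. by move=> sf; apply: bmeasB; [exact: bmeas_at_z|exact: bmeas_at_z']. Qed.

Lemma measurable_square_pairs : measurable square_pairs.
Proof. by apply: measurableX; [exact: measurableX|exact: measurable_period2]. Qed.

Lemma pairs_square : pairs `<=` square_pairs.
Proof. by move=> -[q h] [/= /disc_square hq hh]; split. Qed.

Lemma square_pairs_finite : (leb4 square_pairs < +oo)%E.
Proof.
rewrite /square_pairs product_measure1E; [|exact: measurableX|exact: measurable_period2].
apply: lte_mul_pinfty => //.
  by rewrite ge0_fin_numE//; exact: square_finite.
by have := ltry (L * L); rewrite -period2_measure.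
Qed.

Lemma integrable_square_pairs F : bmeas square_pairs F ->
  leb4.-integrable square_pairs (EFin \o F).
Proof.
move=> bF.
exact (@bmeas_integrable _ _ _ leb4 square_pairs F measurable_square_pairs
  square_pairs_finite bF).
Qed.

Lemma integrable_pairs F : bmeas square_pairs F ->
  leb4.-integrable pairs (EFin \o F).
Proof.
move=> bF; apply: integrableS (integrable_square_pairs bF).
- exact: measurable_square_pairs.
- exact: measurable_pairs.
- exact: pairs_square.
Qed.

Section slices.
Variable h : fn3 R.
Hypothesis mh : measurable_fun (XL Rad L) (unc h).

Let mEh : measurable_fun (disc `*` `[0, L[) (EFin \o unc h).
Proof. by rewrite -XL_setX; apply/measurable_EFinP. Qed.

Lemma measurable_at_z : measurable_fun pairs (at_z h).
Proof.
apply/measurable_EFinP.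
exact (@measurable_pair_fst _ _ _ _ _ disc `[0, L[ (EFin \o unc h)
  measurable_disc (measurable_itv _) mEh).
Qed.

Lemma measurable_at_z' : measurable_fun pairs (at_z' h).
Proof.
apply/measurable_EFinP.
exact (@measurable_pair_snd _ _ _ _ _ disc `[0, L[ (EFin \o unc h)
  measurable_disc (measurable_itv _) mEh).
Qed.

Hypothesis h0 : forall a b c, 0 <= h a b c.

Lemma integral_at_z :
  (\int[leb4]_(p in pairs) (at_z h p)%:E =
   \int[leb3]_(p in XL Rad L) (unc h p)%:E * L%:E)%E.
Proof.
rewrite XL_setX -period_measure.
apply: (@integral_pair_fst _ _ _ _ _ leb2 leb disc `[0, L[ (EFin \o unc h)) => //.
- exact: measurable_disc.
- by move=> p; rewrite lee_fin; exact: h0.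
Qed.

Lemma integral_at_z' :
  (\int[leb4]_(p in pairs) (at_z' h p)%:E =
   \int[leb3]_(p in XL Rad L) (unc h p)%:E * L%:E)%E.
Proof.
rewrite XL_setX -period_measure.
apply: (@integral_pair_snd _ _ _ _ _ leb2 leb disc `[0, L[ (EFin \o unc h)) => //.
- exact: measurable_disc.
- by move=> p; rewrite lee_fin; exact: h0.
Qed.

End slices.
End PairDomain.

(** * Integration by parts and Poincaré inequality for the gap of a test function *)

Section TestFunctionEnergy.
Context {R : realType}.
Variables (Rad L : R) (f : fn3 R).
Hypotheses (hRad : 0 < Rad) (hL : 0 < L) (tf : test_fn Rad L f).
Notation leb := (@lebesgue_measure R).
Notation leb2 := (prodm leb leb).
Notation leb3 := (leb2 \x leb)%E.
Notation leb4 := (leb2 \x leb2)%E.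

Let sf : smooth3 f := tf.1.
Let pf : forall a b c, f a b (c + L) = f a b c := tf.2.1.

Lemma test_fn_vanish a b c : Rad ^+ 2 <= a ^+ 2 + b ^+ 2 -> f a b c = 0.
Proof.
case: tf => _ [_ [r [r0 [rRad h]]]] ab; apply: h; apply: lt_le_trans ab.
by rewrite ltr_pXn2r// nnegrE ltW.
Qed.

Let bmeas_term s : bmeas (square_pairs Rad L)
  (fun p => gap (pds s f) p * gap f p).
Proof.
by apply: bmeasM; [exact: bmeas_gap|exact: (bmeas_gap Rad L [::])].
Qed.

Lemma measurable_square : measurable (square Rad).
Proof. exact: measurableX. Qed.

Lemma bmeas_square_slice (F : (R * R) * (R * R) -> R) q :
  bmeas (square_pairs Rad L) F -> period2 L q ->
  bmeas (square Rad) (fun x => F (x, q)).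
Proof.
move=> bF hq; apply: (@bmeas_comp _ _ _ _ _ _ (square_pairs Rad L) F
  (fun x => (x, q))) => //.
- exact: measurable_square_pairs.
- by apply: measurable_funTS; exact: measurable_pair2.
Qed.

(** The factor [gap f] vanishes outside the disc, so a domain whose chords vary can be traded for a
    product of intervals. *)
Lemma disc_integral_square s q : 
  (\int[leb2]_(x in disc Rad) (gap (pds s f) (x, q) * gap f (x, q))%:E =
   \int[leb2]_(x in square Rad) (gap (pds s f) (x, q) * gap f (x, q))%:E)%E.
Proof.
rewrite integral_mkcond [RHS]integral_mkcond; apply: eq_integral => x _.
rewrite !patchE; have [xd|xd] := boolP (x \in disc Rad).
  by rewrite mem_set//; apply: disc_square => //; exact: set_mem.
case: ifP => // _; rewrite /gap /at_z /at_z' /=.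
by rewrite !test_fn_vanish ?subrr ?mulr0// leNgt; apply: contra xd => xd; exact: mem_set.
Qed.

Let integrable_slice s q : period2 L q ->
  leb2.-integrable (square Rad)
    (fun x => (gap (pds s f) (x, q) * gap f (x, q))%:E).
Proof.
move=> hq.
exact (@bmeas_integrable _ _ _ leb2 (square Rad) _ measurable_square
  (square_finite Rad) (bmeas_square_slice (bmeas_term s) hq)).
Qed.

(** For fixed second coordinate and fixed z, z' the difference of the two slices of [f] vanishes at
    both ends of the interval from [- Rad] to [Rad], so the Dirichlet inequality applies on each
    line. *)
Lemma energy_x1 :
  (\int[leb4]_(p in pairs Rad L) (gap (pds [:: 0%N; 0%N] f) p * gap f p)%:E <= 0)%E.
Proof.
apply: le0_fubini2; [exact: measurable_disc|exact: measurable_period2| |].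
  exact: integrable_pairs.
move=> q hq; rewrite disc_integral_square.
apply: le0_fubini2 => //; first exact: integrable_slice.
move=> b hb; rewrite /gap /at_z /at_z' /=.
apply: (@integral_dirichlet_le0 _ (fun t => f t b q.1 - f t b q.2)
  (fun t => pds [:: 0%N] f t b q.1 - pds [:: 0%N] f t b q.2)
  (fun t => pds [:: 0%N; 0%N] f t b q.1 - pds [:: 0%N; 0%N] f t b q.2)).
- by move=> t; apply: is_deriveB; exact: (smooth3_is_derive0 [::]).
- by move=> t; apply: is_deriveB; exact: (smooth3_is_derive0 [:: 0%N]).
- by move=> t; apply: cvgB; exact: (smooth3_continuous0 (s := [:: 0%N; 0%N])).
- by rewrite gtrN.
- by rewrite !test_fn_vanish ?subrr// ?sqrrN lerDl sqr_ge0.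
- by rewrite !test_fn_vanish ?subrr// lerDl sqr_ge0.
Qed.

Lemma energy_x2 :
  (\int[leb4]_(p in pairs Rad L) (gap (pds [:: 1%N; 1%N] f) p * gap f p)%:E <= 0)%E.
Proof.
apply: le0_fubini2; [exact: measurable_disc|exact: measurable_period2| |].
  exact: integrable_pairs.
move=> q hq; rewrite disc_integral_square.
apply: le0_fubini1 => //; first exact: integrable_slice.
move=> a ha; rewrite /gap /at_z /at_z' /=.
apply: (@integral_dirichlet_le0 _ (fun t => f a t q.1 - f a t q.2)
  (fun t => pds [:: 1%N] f a t q.1 - pds [:: 1%N] f a t q.2)
  (fun t => pds [:: 1%N; 1%N] f a t q.1 - pds [:: 1%N; 1%N] f a t q.2)).
- by move=> t; apply: is_deriveB; exact: (smooth3_is_derive1 [::]).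
- by move=> t; apply: is_deriveB; exact: (smooth3_is_derive1 [:: 1%N]).
- by move=> t; apply: cvgB; exact: (smooth3_continuous1 (s := [:: 1%N; 1%N])).
- by rewrite gtrN.
- by rewrite !test_fn_vanish ?subrr// ?sqrrN lerDr sqr_ge0.
- by rewrite !test_fn_vanish ?subrr// lerDr sqr_ge0.
Qed.

Let bmeas_z s : bmeas (square_pairs Rad L) (at_z (pds s f)).
Proof. exact: bmeas_at_z. Qed.

Let bmeas_z' s : bmeas (square_pairs Rad L) (at_z' (pds s f)).
Proof. exact: bmeas_at_z'. Qed.

Let bmeas_gapf : bmeas (square_pairs Rad L) (gap f).
Proof. exact: (bmeas_gap Rad L [::]). Qed.

Lemma bmeas_period2_slice (F : (R * R) * (R * R) -> R) x :
  bmeas (square_pairs Rad L) F -> disc Rad x ->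
  bmeas (period2 L) (fun q => F (x, q)).
Proof.
move=> bF hx; apply: (@bmeas_comp _ _ _ _ _ _ (square_pairs Rad L) F
  (fun q => (x, q))) => //.
- exact: measurable_square_pairs.
- by move=> q hq; split => //; apply: disc_square.
- by apply: measurable_funTS; exact: measurable_pair1.
Qed.

Let integrable_slice_z (F : (R * R) * (R * R) -> R) x :
  bmeas (square_pairs Rad L) F -> disc Rad x ->
  leb2.-integrable (period2 L) (fun q => (F (x, q))%:E).
Proof.
move=> bF hx.
have fin : (leb2 (period2 L) < +oo)%E by rewrite period2_measure// ltry.
exact (@bmeas_integrable _ _ _ leb2 (period2 L) _ (measurable_period2 L)
  fin (bmeas_period2_slice bF hx)).
Qed.

Lemma integral_period_z a b c :
  (\int[leb]_(z in `[0%R, L[)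
    (pds [:: 2%N; 2%N] f a b z * (f a b z - c) + pds [:: 2%N] f a b z ^+ 2)%:E
   = 0)%E.
Proof.
apply: (@integral_periodic_eq0 _ (fun t => f a b t)
  (fun t => pds [:: 2%N] f a b t) (fun t => pds [:: 2%N; 2%N] f a b t)).
- by move=> t; exact: (smooth3_is_derive2 [::]).
- by move=> t; exact: (smooth3_is_derive2 [:: 2%N]).
- exact: smooth3_continuous2.
- exact: hL.
- by rewrite -[in RHS](add0r L) pf.
- by rewrite -[in RHS](add0r L) (periodic_derive_z _ _ _ sf pf).
Qed.

(** [dz_z] and [dz_z'] are the shares of the two circles in the energy. Each is an exact derivative
    along its own circle; the sign in [dz_z'] arises because [f] at z' enters [gap f] negatively. *)
Let dz_z := fun p => at_z (pds [:: 2%N; 2%N] f) p * gap f p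
                     + at_z (pds [:: 2%N] f) p ^+ 2.
Let dz_z' := fun p => - at_z' (pds [:: 2%N; 2%N] f) p * gap f p
                     + at_z' (pds [:: 2%N] f) p ^+ 2.

Let bmeas_dz_z : bmeas (square_pairs Rad L) dz_z.
Proof. by apply: bmeasD; [exact: bmeasM|exact: bmeas_sqr]. Qed.

Let bmeas_dz_z' : bmeas (square_pairs Rad L) dz_z'.
Proof.
apply: bmeasD; [apply: bmeasM => //|exact: bmeas_sqr].
have := bmeasB (bmeas_cst _ 0) (bmeas_z' [:: 2%N; 2%N]).
by under eq_fun do rewrite sub0r.
Qed.

Lemma energy_z : (\int[leb4]_(p in pairs Rad L) (dz_z p)%:E <= 0)%E.
Proof.
apply: le0_fubini1; [exact: measurable_disc|exact: measurable_period2| |].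
  exact: integrable_pairs.
move=> x hx; apply: le0_fubini2 => //; first exact: integrable_slice_z.
move=> z' _; rewrite -[leRHS](integral_period_z x.1 x.2 (f x.1 x.2 z')).
exact: lexx.
Qed.

Lemma energy_z' : (\int[leb4]_(p in pairs Rad L) (dz_z' p)%:E <= 0)%E.
Proof.
apply: le0_fubini1; [exact: measurable_disc|exact: measurable_period2| |].
  exact: integrable_pairs.
move=> x hx; apply: le0_fubini1 => //; first exact: integrable_slice_z.
move=> z _; rewrite -[leRHS](integral_period_z x.1 x.2 (f x.1 x.2 z)).
rewrite le_eqVlt; apply/orP; left; apply/eqP; apply: eq_integral => t _.
by congr EFin; rewrite /dz_z' /gap /at_z /at_z' /=; ring.
Qed.

(** As [gap (lap f)] is the Laplacian of w = [gap f] in the variables x1, x2, z, z', this is w times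
    its Laplacian plus the circle part of the squared gradient. Integration by parts leaves minus
    the x-part of the Dirichlet energy. *)
Definition pair_energy p := gap (lap f) p * gap f p
  + (at_z (pds [:: 2%N] f) p ^+ 2 + at_z' (pds [:: 2%N] f) p ^+ 2).

Let energy_terms p := (gap (pds [:: 0%N; 0%N] f) p * gap f p
    + gap (pds [:: 1%N; 1%N] f) p * gap f p) + (dz_z p + dz_z' p).

Let pair_energyE : pair_energy = energy_terms.
Proof.
apply/funext => p; rewrite /energy_terms /pair_energy /dz_z /dz_z'.
have key (x x' y y' z z' u u' v v' : R) :
    (x + y + z - (x' + y' + z')) * (u - u') + (v ^+ 2 + v' ^+ 2) =
    ((x - x') * (u - u') + (y - y') * (u - u')) +
    ((z * (u - u') + v ^+ 2) + (- z' * (u - u') + v' ^+ 2)) by ring.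
exact: key.
Qed.

Lemma bmeas_pair_energy : bmeas (square_pairs Rad L) pair_energy.
Proof. by rewrite pair_energyE; do 2 (apply: bmeasD => //). Qed.

Lemma pair_energy_le0 :
  (\int[leb4]_(p in pairs Rad L) (pair_energy p)%:E <= 0)%E.
Proof.
have mp := measurable_pairs Rad L.
have sum (F G : (R * R) * (R * R) -> R) : bmeas (square_pairs Rad L) F ->
    bmeas (square_pairs Rad L) G ->
    (\int[leb4]_(p in pairs Rad L) (F p)%:E <= 0 ->
     \int[leb4]_(p in pairs Rad L) (G p)%:E <= 0 ->
     \int[leb4]_(p in pairs Rad L) (F p + G p)%:E <= 0)%E.
  move=> bF bG F0 G0; rewrite integralD_EFin//; [exact: adde_le0|..].
  - exact (integrable_pairs hRad hL bF).
  - exact (integrable_pairs hRad hL bG).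
rewrite pair_energyE.
apply: (sum (fun p => gap (pds [:: 0%N; 0%N] f) p * gap f p
    + gap (pds [:: 1%N; 1%N] f) p * gap f p) (fun p => dz_z p + dz_z' p)).
- exact: bmeasD.
- exact: bmeasD.
- apply: (sum (fun p => gap (pds [:: 0%N; 0%N] f) p * gap f p)
    (fun p => gap (pds [:: 1%N; 1%N] f) p * gap f p)).
  + exact: bmeas_term.
  + exact: bmeas_term.
  + exact: energy_x1.
  + exact: energy_x2.
- exact: (sum dz_z dz_z' bmeas_dz_z bmeas_dz_z' energy_z energy_z').
Qed.

(** In [L ^+ 3] one factor [L] comes from Cauchy-Schwarz along the circle and the other two from the
    area of the square of pairs (z, z'). *)
Lemma gap_poincare :
  (\int[leb4]_(p in pairs Rad L) (gap f p ^+ 2)%:E <=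
   \int[leb3]_(p in XL Rad L) (L ^+ 3 * unc (pds [:: 2%N] f) p ^+ 2)%:E)%E.
Proof.
rewrite XL_setX; apply: le_fubini1 => //.
- exact: measurable_disc.
- exact: measurable_period2.
- exact (integrable_pairs hRad hL (bmeas_sqr bmeas_gapf)).
- rewrite -XL_setX.
  exact (@bmeas_integrable _ _ _ leb3 (XL Rad L) _ (measurable_XL Rad L)
    (XL_finite hRad hL) (bmeasM (bmeas_cst _ (L ^+ 3))
    (bmeas_sqr (bmeas_XL L hRad [:: 2%N] sf)))).
move=> [a b] hx; rewrite /gap /at_z /at_z' /unc /=.
set P := (\int[leb]_(z in `[0%R, L[) (pds [:: 2%N] f a b z ^+ 2)%:E)%E.
have iP : leb.-integrable `[0, L[ (EFin \o (fun z => pds [:: 2%N] f a b z ^+ 2)).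
  have cc : leb.-integrable `[0, L] (EFin \o (fun z => pds [:: 2%N] f a b z ^+ 2)).
    apply: continuous_integrable_cc => z.
    by apply: cvgM; exact: (smooth3_continuous2 (s := [:: 2%N])).
  apply: integrableS cc; [exact: measurable_itv|exact: measurable_itv|].
  by apply: subset_itvl; rewrite bnd_simp.
have mP : measurable_fun `[0, L[ (fun z => (pds [:: 2%N] f a b z ^+ 2)%:E).
  exact: (measurable_int leb).
have P0 : (0 <= P)%E by apply: integral_ge0 => z _; rewrite lee_fin sqr_ge0.
have Pfin : P \is a fin_num by exact: integrable_fin_num.
apply: (@le_trans _ _ (\int[leb2]_(q in period2 L) (L%:E * P))%E).
  apply: ge0_le_integral => //.
  - exact: measurable_period2.
  - by move=> q _; rewrite lee_fin sqr_ge0.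
  - have := bmeas_period2_slice (bmeas_sqr bmeas_gapf) hx.
    by move=> [mg _]; apply/measurable_EFinP.
  move=> [z z'] [/=]; rewrite !in_itv/= => /andP[z0 zL] /andP[z'0 z'L].
  have := @sqr_sub_le_integral _ (fun t => f a b t)
    (fun t => pds [:: 2%N] f a b t) (fun t => pds [:: 2%N; 2%N] f a b t)
    (fun t => smooth3_is_derive2 [::] a b t sf)
    (fun t => smooth3_is_derive2 [:: 2%N] a b t sf) 0 L.
  rewrite subr0 => h; have [zz'|/ltW z'z] := leP z z'.
    by rewrite -sqrrN opprB; apply: h => //; exact: ltW.
  by apply: h => //; exact: ltW.
have -> : (\int[leb2]_(q in period2 L) (L%:E * P) = L%:E * P * (L * L)%:E)%E.
  have := @integral_cst _ _ _ leb2 _ (measurable_period2 L) (L%:E * P)%E.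
  by rewrite -period2_measure.
under [leRHS]eq_integral do rewrite EFinM.
rewrite ge0_integralZl//; last 2 first.
- by move=> z _; rewrite lee_fin sqr_ge0.
- by rewrite lee_fin exprn_ge0// ltW.
rewrite -/P -(fineK Pfin) -!EFinM lee_fin.
by rewrite le_eqVlt; apply/orP; left; apply/eqP; ring.
Qed.

End TestFunctionEnergy.

(** * Energy estimate *)

Section L2Norms.
Context {R : realType}.
Variables Rad L : R.
Hypotheses (hRad : 0 < Rad) (hL : 0 < L).
Notation leb := (@lebesgue_measure R).
Notation leb2 := (prodm leb leb).
Notation leb3 := (leb2 \x leb)%E.
Implicit Types h : fn3 R.

Definition mXL h := measurable_fun (XL Rad L) (unc h).

Definition sub3 h1 h2 : fn3 R := fun a b c => h1 a b c - h2 a b c.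

Lemma mXL_sub h1 h2 : mXL h1 -> mXL h2 -> mXL (sub3 h1 h2).
Proof. exact: measurable_funB. Qed.

Lemma mXL_pds f s : smooth3 f -> mXL (pds s f).
Proof. by move=> sf; apply: measurable_funTS; exact: smooth3_measurable. Qed.

Lemma mXL_scaled_sqr (q : R) h : mXL h ->
  measurable_fun (XL Rad L) (fun p => q * unc h p ^+ 2).
Proof. by move=> mh; apply: measurable_funM => //; exact: measurable_funM. Qed.

Lemma bmeas_lap f : smooth3 f -> bmeas (XL Rad L) (unc (lap f)).
Proof.
move=> sf; apply: bmeasD; last exact: (bmeas_XL L hRad [:: 2%N; 2%N] sf).
apply: bmeasD; first exact: (bmeas_XL L hRad [:: 0%N; 0%N] sf).
exact: (bmeas_XL L hRad [:: 1%N; 1%N] sf).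
Qed.

(** Holds by conversion, since [prodm] unfolds to the product measure used in [L2sq]; rewriting with
    it brings in the sigma-finite structure. *)
Lemma L2sqE h : L2sq Rad L h =
  (\int[leb3]_(p in XL Rad L) ((unc h p) ^+ 2)%:E)%E.
Proof. by []. Qed.

Lemma L2sq_ge0 h : (0 <= L2sq Rad L h)%E.
Proof. by apply: integral_ge0 => p _; rewrite lee_fin sqr_ge0. Qed.

Lemma L2sq_fin h : bmeas (XL Rad L) (unc h) -> (L2sq Rad L h < +oo)%E.
Proof.
move=> bh; have := @bmeas_integrable _ _ _ leb3 (XL Rad L) _
  (measurable_XL Rad L) (XL_finite hRad hL) (bmeas_sqr bh).
move=> /integrableP[_]; apply: le_lt_trans; rewrite L2sqE.
rewrite le_eqVlt; apply/orP; left; apply/eqP; apply: eq_integral => p _.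
by rewrite /= ger0_norm// sqr_ge0.
Qed.

Lemma integral_comb (a b c : R) h1 h2 h3 : 0 <= a -> 0 <= b -> 0 <= c ->
  mXL h1 -> mXL h2 -> mXL h3 ->
  (\int[leb3]_(p in XL Rad L)
     (a * unc h1 p ^+ 2 + b * unc h2 p ^+ 2 + c * unc h3 p ^+ 2)%:E =
   a%:E * L2sq Rad L h1 + b%:E * L2sq Rad L h2 + c%:E * L2sq Rad L h3)%E.
Proof.
move=> a0 b0 c0 m1 m2 m3; have mX := measurable_XL Rad L.
have sq0 (k : R) h p : 0 <= k -> (0 <= (k * unc h p ^+ 2)%:E)%E.
  by move=> k0; rewrite lee_fin mulr_ge0// sqr_ge0.
have msq (k : R) h : mXL h ->
    measurable_fun (XL Rad L) (fun p => (k * unc h p ^+ 2)%:E).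
  by move=> mh; apply/measurable_EFinP; exact: mXL_scaled_sqr.
have Z (k : R) h : 0 <= k -> mXL h ->
    (\int[leb3]_(p in XL Rad L) (k * unc h p ^+ 2)%:E = k%:E * L2sq Rad L h)%E.
  move=> k0 mh; rewrite L2sqE -ge0_integralZl//.
  - by apply/measurable_EFinP; exact: measurable_funM.
  - by move=> p _; rewrite lee_fin sqr_ge0.
under eq_integral do rewrite EFinD EFinD.
rewrite ge0_integralD//; last 4 first.
- by move=> p _; apply: adde_ge0; exact: sq0.
- by apply: emeasurable_funD; exact: msq.
- by move=> p _; exact: sq0.
- exact: msq.
rewrite ge0_integralD//; last 4 first.
- by move=> p _; exact: sq0.
- exact: msq.
- by move=> p _; exact: sq0.
- exact: msq.
by rewrite !Z.
Qed.

Lemma L2sq_le2 (a b : R) h h1 h2 : 0 <= a -> 0 <= b ->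
  mXL h -> mXL h1 -> mXL h2 ->
  (forall x y z, h x y z ^+ 2 <= a * h1 x y z ^+ 2 + b * h2 x y z ^+ 2) ->
  (L2sq Rad L h <= a%:E * L2sq Rad L h1 + b%:E * L2sq Rad L h2)%E.
Proof.
move=> a0 b0 mh m1 m2 le_h.
have := @integral_comb a b 0 h1 h2 h2 a0 b0 (lexx 0) m1 m2 m2.
rewrite mul0e adde0 => <-; rewrite L2sqE; apply: ge0_le_integral.
- exact: measurable_XL.
- by move=> p _; rewrite lee_fin sqr_ge0.
- by apply/measurable_EFinP; exact: measurable_funM.
- apply/measurable_EFinP.
  have := measurable_funD (measurable_funD (mXL_scaled_sqr a m1)
    (mXL_scaled_sqr b m2)) (mXL_scaled_sqr 0 m2).
  exact.
- by move=> [[x y] z] _; rewrite lee_fin mul0r addr0; exact: le_h.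
Qed.

Lemma L2sq_sub_le h1 h2 h3 : mXL h1 -> mXL h2 -> mXL h3 ->
  (L2sq Rad L (sub3 h1 h2) <=
   2%:E * L2sq Rad L (sub3 h1 h3) +
   2%:E * L2sq Rad L (sub3 h2 h3))%E.
Proof.
move=> m1 m2 m3; apply: L2sq_le2 => //; try exact: mXL_sub.
have key (a b c : R) : (a - b) ^+ 2 <= 2 * (a - c) ^+ 2 + 2 * (b - c) ^+ 2.
  rewrite -subr_ge0 (_ : _ - _ = (a + b - 2 * c) ^+ 2) ?sqr_ge0//; ring.
by move=> x y z; exact: key.
Qed.

Lemma L2sq_le_sub h1 h2 : mXL h1 -> mXL h2 ->
  (L2sq Rad L h1 <=
   2%:E * L2sq Rad L (sub3 h1 h2) + 2%:E * L2sq Rad L h2)%E.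
Proof.
move=> m1 m2; apply: L2sq_le2 => //; first exact: mXL_sub.
have key (a b : R) : a ^+ 2 <= 2 * (a - b) ^+ 2 + 2 * b ^+ 2.
  rewrite -subr_ge0 (_ : _ - _ = (a - 2 * b) ^+ 2) ?sqr_ge0//; ring.
by move=> x y z; exact: key.
Qed.

End L2Norms.

(** * Pointwise bounds from semiconvexity *)

Lemma smooth1_is_derive (R : realType) (V : R -> R) (x : R) : smooth1 V ->
  is_derive x 1 (derive1 V) (derive1 (derive1 V) x).
Proof.
by move=> hV; apply: DeriveDef; [exact: (hV 1%N)|rewrite derive1E].
Qed.

(** V'(t) + c^2 t is nondecreasing, by the mean value theorem applied to V'. *)
Lemma semiconvex_monotone (R : realType) (V : R -> R) (c s t : R) :
  smooth1 V -> (forall t, - c ^+ 2 <= derive1 (derive1 V) t) ->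
  - c ^+ 2 * (s - t) ^+ 2 <= (derive1 V s - derive1 V t) * (s - t).
Proof.
move=> hV hV2.
have dV x := smooth1_is_derive x hV.
have le_case (a b : R) : a <= b ->
    - c ^+ 2 * (b - a) ^+ 2 <= (derive1 V b - derive1 V a) * (b - a).
  move=> ab.
  have [|x _ ->] := MVT_segment ab (fun x _ => dV x).
    by apply: continuous_subspaceT; exact: is_derive1_continuous.
  by rewrite -mulrA -expr2 ler_wpM2r// sqr_ge0.
have [st|/ltW ts] := leP s t; last exact: le_case.
have := le_case _ _ st; move: (derive1 V s) (derive1 V t) => ds dt.
by rewrite -[(t - s) ^+ 2]sqrrN -[(dt - ds) * _]mulrNN !opprB.
Qed.

(* With [y = dl - du] and [x = da - dp], the right-hand side is the slack in the
   hypothesis plus nonnegative quadratic forms; [k] stands for [e^-1]. *)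
Lemma perturbed_monotone (R : realType) (c e k dl da dp du : R) :
  0 < e -> e * k = 1 -> - c ^+ 2 * dp ^+ 2 <= du * dp ->
  0 <= dl * da + (c ^+ 2 + e * (c ^+ 2 + 1)) * da ^+ 2 + e * dl ^+ 2
     + (c ^+ 2 * (1 + k) + k + 1) * ((dl - du) ^+ 2 + (da - dp) ^+ 2).
Proof.
move=> e0 ek mono.
have k0 : 0 < k by rewrite -(pmulr_rgt0 _ e0) ek ltr01.
set y := dl - du; set x := da - dp.
have young (u v : R) : 0 <= e * u ^+ 2 + k * v ^+ 2 + u * v.
  have -> : e * u ^+ 2 + k * v ^+ 2 + u * v =
      k * ((e * u + v / 2) ^+ 2 + 3 / 4 * v ^+ 2) +
      (1 - e * k) * (e * u ^+ 2 + u * v) by field.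
  rewrite ek subrr mul0r addr0 mulr_ge0 ?(ltW k0)// addr_ge0 ?sqr_ge0//.
  by rewrite mulr_ge0 ?sqr_ge0//; lra.
have young2 (u v : R) : 0 <= e * u ^+ 2 + k * v ^+ 2 + 2 * u * v.
  have -> : e * u ^+ 2 + k * v ^+ 2 + 2 * u * v =
      k * (e * u + v) ^+ 2 + (1 - e * k) * (e * u ^+ 2 + 2 * u * v) by ring.
  by rewrite ek subrr mul0r addr0 mulr_ge0 ?(ltW k0)// sqr_ge0.
(* Expanding [du * dp + c ^+ 2 * dp ^+ 2] with [du = dl - y] and [dp = da - x] produces, up to sign,
   the cross terms [da * y], [dl * x], [2 * c ^+ 2 * da * x] and [x * y]. The forms [h1] to [h4]
   absorb one each, and [h5] makes the coefficients of [x ^+ 2] and [y ^+ 2] equal. *)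
have h1 := young da y; have h2 := young dl x.
have h3 : 0 <= c ^+ 2 * (e * da ^+ 2 + k * x ^+ 2 + 2 * da * x).
  by rewrite mulr_ge0 ?sqr_ge0//; exact: young2.
have h4 : 0 <= x ^+ 2 + y ^+ 2 - x * y.
  have -> : x ^+ 2 + y ^+ 2 - x * y = (x - y / 2) ^+ 2 + 3 / 4 * y ^+ 2 by field.
  by rewrite addr_ge0 ?sqr_ge0// mulr_ge0 ?sqr_ge0//; lra.
have h5 : 0 <= c ^+ 2 * (1 + k) * y ^+ 2.
  by rewrite mulr_ge0 ?sqr_ge0// mulr_ge0 ?sqr_ge0//; lra.
have -> : dl * da + (c ^+ 2 + e * (c ^+ 2 + 1)) * da ^+ 2 + e * dl ^+ 2
     + (c ^+ 2 * (1 + k) + k + 1) * (y ^+ 2 + x ^+ 2) =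
  (du * dp - (- c ^+ 2 * dp ^+ 2)) +
  (e * da ^+ 2 + k * y ^+ 2 + da * y) + (e * dl ^+ 2 + k * x ^+ 2 + dl * x) +
  c ^+ 2 * (e * da ^+ 2 + k * x ^+ 2 + 2 * da * x) +
  (x ^+ 2 + y ^+ 2 - x * y) + c ^+ 2 * (1 + k) * y ^+ 2.
  by rewrite /x /y; ring.
have h0 : 0 <= du * dp - (- c ^+ 2 * dp ^+ 2) by rewrite subr_ge0.
exact: addr_ge0 (addr_ge0 (addr_ge0 (addr_ge0 (addr_ge0 h0 h1) h2) h3) h4) h5.
Qed.

Section EnergyEstimate.
Context {R : realType}.
Variables (Rad L c : R) (V : R -> R) (phi : fn3 R) (f : fn3 R).
Hypotheses (hRad : 0 < Rad) (hL : 0 < L) (cL : c ^+ 2 * L ^+ 2 <= 1).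
Hypotheses (hV : smooth1 V)
  (hV2 : forall t : R, - c ^+ 2 <= derive1 (derive1 V) t).
Hypotheses (mphi : mXL Rad L phi) (tf : test_fn Rad L f).
Variables (e k : R).
Hypotheses (e0 : 0 < e) (ek : e * k = 1)
  (eL : e * (c ^+ 2 + 1) * L ^+ 2 <= 1 / 2).
Notation leb := (@lebesgue_measure R).
Notation leb2 := (prodm leb leb).
Notation leb3 := (leb2 \x leb)%E.
Notation leb4 := (leb2 \x leb2)%E.

Let sf : smooth3 f := tf.1.
Let U : fn3 R := fun x y z => derive1 V (phi x y z).
(** [K] and [C] are the coefficients of [perturbed_monotone]. Together [cL] and [eL] give
    [K * L ^+ 2 <= 3 / 2], which is below the 2 contributed by the two circles. *)
Let K := c ^+ 2 + e * (c ^+ 2 + 1).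
Let C := c ^+ 2 * (1 + k) + k + 1.
Let k0 : 0 < k.
Proof. by rewrite -(pmulr_rgt0 _ e0) ek ltr01. Qed.
Let C0 : 0 <= C.
Proof.
by rewrite /C !addr_ge0 ?(ltW k0)// mulr_ge0 ?sqr_ge0// addr_ge0 ?(ltW k0).
Qed.

Lemma mXL_dV : mXL Rad L U.
Proof.
apply: (@measurableT_comp _ _ _ _ _ _ (derive1 V)) => //.
apply: continuous_measurable_fun.
exact: is_derive1_continuous (fun x => smooth1_is_derive x hV).
Qed.

(** The error density at a single point. The factors 2 come from splitting the square of a gap into
    the squares at its two points. *)
Let H : fn3 R := fun x y z => 2 * e * unc (lap f) (x, y, z) ^+ 2
  + 2 * C * unc (sub3 (lap f) U) (x, y, z) ^+ 2
  + 2 * C * unc (sub3 f phi) (x, y, z) ^+ 2.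

Let mlap : mXL Rad L (lap f).
Proof. by have [] := bmeas_lap L hRad sf. Qed.

Let mfphi : mXL Rad L (sub3 f phi).
Proof. apply: mXL_sub => //; exact: (@mXL_pds _ Rad L f [::] sf). Qed.

Let mlapU : mXL Rad L (sub3 (lap f) U).
Proof. by apply: mXL_sub => //; exact: mXL_dV. Qed.

Let mH : mXL Rad L H.
Proof.
have := measurable_funD (measurable_funD (mXL_scaled_sqr (2 * e) mlap)
  (mXL_scaled_sqr (2 * C) mlapU)) (mXL_scaled_sqr (2 * C) mfphi).
by apply: eq_measurable_fun => -[[x y] z] _.
Qed.

Let H0 x y z : 0 <= H x y z.
Proof.
by rewrite /H !addr_ge0// mulr_ge0 ?sqr_ge0// mulr_ge0// ltW.
Qed.

(** Semiconvexity between the two values of [phi], perturbed to the values of [f] and [lap f],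
    bounds [gap (lap f) p * gap f p] from below by [- K * gap f p ^+ 2] minus errors; the errors are
    then distributed over the two points. *)
Lemma pointwise_energy p :
  at_z (pds [:: 2%N] f) p ^+ 2 + at_z' (pds [:: 2%N] f) p ^+ 2 <=
  pair_energy f p + K * gap f p ^+ 2 + (at_z H p + at_z' H p).
Proof.
case: p => [[x y] [z z']].
have key (v v' l l' a a' u u' p p' : R) :
    - c ^+ 2 * (p - p') ^+ 2 <= (u - u') * (p - p') ->
    v ^+ 2 + v' ^+ 2 <= (l - l') * (a - a') + (v ^+ 2 + v' ^+ 2) + K * (a - a') ^+ 2
     + ((2 * e * l ^+ 2 + 2 * C * (l - u) ^+ 2 + 2 * C * (a - p) ^+ 2) +
        (2 * e * l' ^+ 2 + 2 * C * (l' - u') ^+ 2 + 2 * C * (a' - p') ^+ 2)).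
  move=> /(perturbed_monotone (l - l') (a - a') e0 ek).
  rewrite -/K -/C; move: K => K1; move: C C0 => C1 C1_ge0 h.
  have sq (s t : R) : (s - t) ^+ 2 <= 2 * (s ^+ 2 + t ^+ 2).
    by rewrite -subr_ge0 (_ : _ - _ = (s + t) ^+ 2) ?sqr_ge0//; ring.
  have h1 : e * (l - l') ^+ 2 <= e * (2 * (l ^+ 2 + l' ^+ 2)).
    by rewrite ler_wpM2l// ltW.
  have h2 : C1 * (l - l' - (u - u')) ^+ 2 <= C1 * (2 * ((l - u) ^+ 2 + (l' - u') ^+ 2)).
    rewrite ler_wpM2l//; have := sq (l - u) (l' - u').
    by rewrite (_ : l - u - (l' - u') = l - l' - (u - u'))//; ring.
  have h3 : C1 * (a - a' - (p - p')) ^+ 2 <= C1 * (2 * ((a - p) ^+ 2 + (a' - p') ^+ 2)).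
    rewrite ler_wpM2l//; have := sq (a - p) (a' - p').
    by rewrite (_ : a - p - (a' - p') = a - a' - (p - p'))//; ring.
  by move: h h1 h2 h3; rewrite !mulrDr; lra.
exact: key (semiconvex_monotone (phi x y z) (phi x y z') hV hV2).
Qed.

Let A := L2sq Rad L (pds [:: 2%N] f).

Let fz2 : fn3 R := fun x y z => pds [:: 2%N] f x y z ^+ 2.

Let mfz2 : mXL Rad L fz2.
Proof.
have m := @mXL_pds _ Rad L f [:: 2%N] sf.
exact: (measurable_funM m m).
Qed.

Let fz2_ge0 x y z : 0 <= fz2 x y z.
Proof. exact: sqr_ge0. Qed.

Let integrable_Hz : (\int[leb3]_(p in XL Rad L) (unc H p)%:E < +oo)%E ->
  leb4.-integrable (pairs Rad L) (fun p => (at_z H p + at_z' H p)%:E).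
Proof.
move=> Hoo.
have fin (F : (R * R) * (R * R) -> R) : measurable_fun (pairs Rad L) F ->
   (forall p, 0 <= F p) ->
   (\int[leb4]_(p in pairs Rad L) (F p)%:E =
     \int[leb3]_(p in XL Rad L) (unc H p)%:E * L%:E)%E ->
   leb4.-integrable (pairs Rad L) (EFin \o F).
  move=> mF F0 FE; apply/integrableP; split; first exact/measurable_EFinP.
  under eq_integral do rewrite /= ger0_norm//.
  rewrite FE; apply: lte_mul_pinfty => //; last exact: ltry.
    by apply: integral_ge0 => -[[x y] z] _; rewrite lee_fin; exact: H0.
  rewrite ge0_fin_numE//.
  by apply: integral_ge0 => -[[x y] z] _; rewrite lee_fin; exact: H0.
have iz := fin (at_z H) (measurable_at_z mH) (fun p => H0 _ _ _)
  (integral_at_z hL mH H0).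
have iz' := fin (at_z' H) (measurable_at_z' mH) (fun p => H0 _ _ _)
  (integral_at_z' hL mH H0).
by apply: (integrableD _ iz iz'); exact: measurable_pairs.
Qed.

Let A_fin : A \is a fin_num.
Proof.
rewrite ge0_fin_numE ?L2sq_ge0//; apply: (L2sq_fin hRad hL).
exact: (bmeas_XL L hRad [:: 2%N] sf).
Qed.

Let K0 : 0 <= K.
Proof.
by rewrite /K addr_ge0 ?sqr_ge0// mulr_ge0 ?(ltW e0)// addr_ge0 ?sqr_ge0.
Qed.

(** Obtained by integrating [pointwise_energy] over the pairs: the pair energy is nonpositive and
    drops out, the Poincaré inequality bounds the gap term, and terms living at one point pick up
    the factor [L]. *)
Lemma integral_dz_le : (\int[leb3]_(p in XL Rad L) (unc H p)%:E < +oo)%E ->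
  (A * L%:E + A * L%:E <= K%:E * ((L ^+ 3)%:E * A) +
    (\int[leb3]_(p in XL Rad L) (unc H p)%:E * L%:E +
     \int[leb3]_(p in XL Rad L) (unc H p)%:E * L%:E))%E.
Proof.
move=> Hoo; have mp := measurable_pairs Rad L.
have bg : bmeas (square_pairs Rad L) (gap f) := bmeas_gap Rad L [::] sf.
have bz := bmeas_sqr (bmeas_at_z Rad L [:: 2%N] sf).
have bz' := bmeas_sqr (bmeas_at_z' Rad L [:: 2%N] sf).
have be := bmeas_pair_energy tf.
have bK := bmeasM (bmeas_cst (square_pairs Rad L) K) (bmeas_sqr bg).
have mHz := measurable_at_z mH; have mHz' := measurable_at_z' mH.
have mfz := measurable_at_z mfz2; have mfz' := measurable_at_z' mfz2.
have ie := integrable_pairs hRad hL be.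
have iK := integrable_pairs hRad hL bK.
have ieK := integrable_pairs hRad hL (bmeasD be bK).
have iz := integrable_pairs hRad hL (bmeasD bz bz').
have iH := integrable_Hz Hoo.
have lhs : (\int[leb4]_(p in pairs Rad L) (at_z fz2 p + at_z' fz2 p)%:E =
    A * L%:E + A * L%:E)%E.
  under eq_integral do rewrite EFinD.
  rewrite ge0_integralD//; first by rewrite integral_at_z// integral_at_z'.
  - by move=> p _; rewrite lee_fin; exact: fz2_ge0.
  - exact/measurable_EFinP.
  - by move=> p _; rewrite lee_fin; exact: fz2_ge0.
  - exact/measurable_EFinP.
have rhs : (\int[leb4]_(p in pairs Rad L) (at_z H p + at_z' H p)%:E =
    \int[leb3]_(p in XL Rad L) (unc H p)%:E * L%:E +
    \int[leb3]_(p in XL Rad L) (unc H p)%:E * L%:E)%E.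
  under eq_integral do rewrite EFinD.
  rewrite ge0_integralD//; first by rewrite integral_at_z// integral_at_z'.
  - by move=> p _; rewrite lee_fin; exact: H0.
  - exact/measurable_EFinP.
  - by move=> p _; rewrite lee_fin; exact: H0.
  - exact/measurable_EFinP.
rewrite -lhs -rhs.
apply: (@le_trans _ _ (\int[leb4]_(p in pairs Rad L)
   ((pair_energy f p + K * gap f p ^+ 2) + (at_z H p + at_z' H p))%:E)%E).
  apply: le_integral => //.
  - by apply: (integrableD _ ieK iH).
  - by move=> p _; rewrite lee_fin; exact: pointwise_energy.
rewrite integralD_EFin//; apply: leeD => //.
rewrite integralD_EFin//.
apply: (@le_trans _ _ (0 + \int[leb4]_(p in pairs Rad L) (K * gap f p ^+ 2)%:E)%E).
  by apply: leeD => //; exact: pair_energy_le0.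
rewrite add0e.
have -> : (\int[leb4]_(p in pairs Rad L) (K * gap f p ^+ 2)%:E =
    K%:E * \int[leb4]_(p in pairs Rad L) (gap f p ^+ 2)%:E)%E.
  under eq_integral do rewrite EFinM.
  rewrite ge0_integralZl//.
  - apply/measurable_EFinP.
    have [mg _] := bmeas_sqr bg.
    by apply: measurable_funS mg; [exact: measurable_square_pairs|exact: pairs_square].
  - by move=> p _; rewrite lee_fin sqr_ge0.
rewrite lee_wpmul2l ?lee_fin//; apply: le_trans (gap_poincare hRad hL tf) _.
rewrite le_eqVlt; apply/orP; left; apply/eqP.
under eq_integral do rewrite EFinM.
rewrite ge0_integralZl//.
- exact: measurable_XL.
- exact/measurable_EFinP.
- by move=> p _; rewrite lee_fin sqr_ge0.
- by rewrite lee_fin exprn_ge0// ltW.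
Qed.

Lemma energy_estimate :
  (A <= (8 * e)%:E * L2sq Rad L (lap f) + (8 * C)%:E *
   (L2sq Rad L (sub3 (lap f) U) + L2sq Rad L (sub3 f phi)))%E.
Proof.
have C8 : 0 <= 2 * C by rewrite mulr_ge0.
have e8 : 0 <= 2 * e by rewrite mulr_ge0// ltW.
have HE := integral_comb e8 C8 C8 mlap mlapU mfphi.
have HE' : (\int[leb3]_(p in XL Rad L) (unc H p)%:E = (2 * e)%:E * L2sq Rad L (lap f)
    + (2 * C)%:E * L2sq Rad L (sub3 (lap f) U)
    + (2 * C)%:E * L2sq Rad L (sub3 f phi))%E.
  by rewrite -HE; apply: eq_integral => -[[x y] z] _.
have h4 : (A <= 4%:E * \int[leb3]_(p in XL Rad L) (unc H p)%:E)%E.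
  set I := (\int[leb3]_(p in XL Rad L) (unc H p)%:E)%E.
  have I0 : (0 <= I)%E.
    by apply: integral_ge0 => -[[x y] z] _; rewrite lee_fin; exact: H0.
  (* [phi] is merely measurable here, so the integral of [H] may be infinite; the bound is then
     trivial. *)
  have [Ioo|] := ltP I +oo%E; last first.
    by rewrite leye_eq => /eqP ->; rewrite gt0_muley ?leey// lte_fin.
  have := integral_dz_le Ioo; rewrite -/I.
  have Ifin : I \is a fin_num by rewrite ge0_fin_numE.
  have A0 : 0 <= fine A by rewrite fine_ge0// L2sq_ge0.
  rewrite -(fineK A_fin) -(fineK Ifin) -!EFinM -!EFinD !lee_fin.
  move: (fine A) A0 (fine I) => a a0 i h.
  (* Absorption: from [2 * a <= 3 / 2 * a + 2 * i] follows [a <= 4 * i]. This 4 times the 2 in [H]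
     is the 8 of the estimate. *)
  have h1 : K * L ^+ 2 <= 3 / 2.
    by rewrite /K mulrDl; move: cL eL; lra.
  have h2 : L * (2 * a) <= L * (K * L ^+ 2 * a + 2 * i) by move: h; lra.
  have h3 : 2 * a <= K * L ^+ 2 * a + 2 * i by rewrite -(ler_pM2l hL).
  have := ler_wpM2r a0 h1; lra.
apply: (le_trans h4); rewrite HE'.
have := L2sq_ge0 Rad L (sub3 f phi); have := L2sq_ge0 Rad L (sub3 (lap f) U).
have := L2sq_ge0 Rad L (lap f).
move: (L2sq _ _ (lap f)) (L2sq _ _ (sub3 (lap f) U)) (L2sq _ _ (sub3 f phi)).
move=> X Y Z X0 Y0 Z0.
have pos (q : R) (T : \bar R) : 0 <= q -> (0 <= T -> 0 <= q%:E * T)%E.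
  by move=> q0 T0; apply: mule_ge0; rewrite ?lee_fin.
rewrite [X in (X <= _)%E]ge0_muleDr ?adde_ge0 ?pos//.
rewrite [in X in (X <= _)%E]ge0_muleDr ?pos// ge0_muleDr// !muleA -!EFinM -addeA.
by rewrite !mulrA (_ : 4 * 2 = 8 :> R)// -natrM.
Qed.

End EnergyEstimate.

(** * Passage to the limit *)

Section SecondSequence.
Context {R : realType}.
Variables (Rad L : R) (f g : fn3 R).
Hypotheses (hRad : 0 < Rad) (hL : 0 < L).
Hypotheses (tf : test_fn Rad L f) (tg : test_fn Rad L g).
Notation leb := (@lebesgue_measure R).
Notation leb2 := (prodm leb leb).
Notation leb3 := (leb2 \x leb)%E.

Let sf : smooth3 f := tf.1.
Let sg : smooth3 g := tg.1.
Let w s := sub3 (pds s f) (pds s g).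

Let bmeas_w s : bmeas (XL Rad L) (unc (w s)).
Proof.
exact: (bmeasB (bmeas_XL L hRad s sf) (bmeas_XL L hRad s sg)).
Qed.

Let continuous_w s a b : continuous (w s a b).
Proof. by move=> t; apply: cvgB; exact: smooth3_continuous2. Qed.

(** On each circle periodicity turns the integral of u_z^2 into that of - u u_zz, where u = f - g;
    Young's inequality with weights [k] and [e] splits the product. *)
Lemma derive_z_interp (e k : R) : 0 < e -> e * k = 1 ->
  (L2sq Rad L (w [:: 2%N]) <=
   k%:E * L2sq Rad L (w [::]) + e%:E * L2sq Rad L (w [:: 2%N; 2%N]))%E.
Proof.
move=> e0 ek.
have k0 : 0 < k by rewrite -(pmulr_rgt0 _ e0) ek ltr01.
have := integral_comb (ltW k0) (ltW e0) (lexx 0) (bmeas_w [::]).1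
  (bmeas_w [:: 2%N; 2%N]).1 (bmeas_w [::]).1.
rewrite mul0e adde0 => <-; rewrite L2sqE.
have bsq s := bmeas_sqr (bmeas_w s).
have int F : bmeas (XL Rad L) F -> leb3.-integrable (XL Rad L) (EFin \o F).
  exact: (bmeas_integrable (mu := leb3) (measurable_XL Rad L) (XL_finite hRad hL)).
have i1 := int _ (bsq [:: 2%N]).
have i2 := int _ (bmeasD (bmeasD (bmeasM (bmeas_cst _ k) (bsq [::]))
  (bmeasM (bmeas_cst _ e) (bsq [:: 2%N; 2%N]))) (bmeasM (bmeas_cst _ 0) (bsq [::]))).
move: i1 i2; rewrite XL_setX => i1 i2.
apply: le_fubini1 => //; first exact: measurable_disc.
move=> [a b] _.
have period : (\int[leb]_(t in `[0%R, L[)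
   (w [:: 2%N; 2%N] a b t * (w [::] a b t - 0) + w [:: 2%N] a b t ^+ 2)%:E = 0)%E.
  apply: (@integral_periodic_eq0 _ (w [::] a b) (w [:: 2%N] a b)
    (w [:: 2%N; 2%N] a b)).
  - by move=> t; apply: is_deriveB; exact: (smooth3_is_derive2 [::]).
  - by move=> t; apply: is_deriveB; exact: (smooth3_is_derive2 [:: 2%N]).
  - exact: continuous_w.
  - exact: hL.
  - by rewrite /w /sub3 /= -[in RHS](add0r L) tf.2.1 tg.2.1.
  - rewrite /w /sub3 -[in RHS](add0r L).
    by rewrite (periodic_derive_z _ _ _ sf tf.2.1) (periodic_derive_z _ _ _ sg tg.2.1).
pose F1 t := w [:: 2%N; 2%N] a b t * (w [::] a b t - 0) + w [:: 2%N] a b t ^+ 2.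
(* The summand with coefficient 0 matches the three-term shape of [integral_comb], used here for two
   terms. *)
pose F2 t := k * w [::] a b t ^+ 2 + e * w [:: 2%N; 2%N] a b t ^+ 2
  + 0 * w [::] a b t ^+ 2.
have cF1 : continuous F1.
  move=> t; apply: cvgD; last by apply: cvgM; exact: continuous_w.
  by apply: cvgM; [exact: continuous_w|apply: cvgB; [exact: continuous_w|exact: cvg_cst]].
have cF2 : continuous F2.
  have csq (q : R) s : continuous (fun t => q * w s a b t ^+ 2).
    by move=> t; apply: cvgM; [exact: cvg_cst|apply: cvgM; exact: continuous_w].
  by move=> t; do 2 (try apply: cvgD); exact: csq.
have cw : continuous (fun t => w [:: 2%N] a b t ^+ 2).
  by move=> t; apply: cvgM; exact: continuous_w.
have co (F : R -> R) : continuous F -> leb.-integrable `[0, L[ (EFin \o F).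
  move=> cF; apply: integrableS (continuous_integrable_cc 0 L cF).
  - exact: measurable_itv.
  - exact: measurable_itv.
  - by apply: subset_itvl; rewrite bnd_simp.
(* Adding [F1], whose integral over a period is zero, makes the inequality hold pointwise. *)
apply: (@le_trans _ _ (\int[leb]_(t in `[0%R, L[) (F1 t + F2 t)%:E)%E).
  apply: le_integral => //.
  - exact: (co _ cw).
  - by apply: co => t; apply: cvgD; [exact: cF1|exact: cF2].
  have key (u u1 u2 : R) : u1 ^+ 2 <=
      u2 * (u - 0) + u1 ^+ 2 + (k * u ^+ 2 + e * u2 ^+ 2 + 0 * u ^+ 2).
    have -> : u2 * (u - 0) + u1 ^+ 2 + (k * u ^+ 2 + e * u2 ^+ 2 + 0 * u ^+ 2) =
      u1 ^+ 2 + (k * ((e * u2 + u / 2) ^+ 2 + 3 / 4 * u ^+ 2) +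
      (1 - e * k) * (e * u2 ^+ 2 + u2 * u)) by field.
    rewrite ek subrr mul0r addr0 lerDl mulr_ge0 ?(ltW k0)// addr_ge0 ?sqr_ge0//.
    by rewrite mulr_ge0 ?sqr_ge0//; lra.
  by move=> t _; rewrite lee_fin; exact: key.
rewrite integralD_EFin//; [|exact: co|exact: co].
by rewrite period add0e.
Qed.
End SecondSequence.

(** * Sequences tending to zero *)

Section Vanishing.
Context {R : realType}.
Implicit Types u v r : nat -> \bar R.

(** One-sided, with extended real values: for the nonnegative [L2sq] it means convergence to zero,
    and it agrees with [L2_conv] by conversion. *)
Definition vanishes u :=
  forall e : R, 0 < e -> exists N, forall n, (N <= n)%N -> (u n < e%:E)%E.

Lemma vanishesD u v : vanishes u -> vanishes v ->
  vanishes (fun n => u n + v n)%E.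
Proof.
move=> hu hv e e0; have e2 : 0 < e / 2 by rewrite divr_gt0.
have [N hN] := hu _ e2; have [M hM] := hv _ e2.
exists (maxn N M) => n; rewrite geq_max => /andP[Nn Mn].
by rewrite [e]splitr EFinD lteD ?hN ?hM.
Qed.

Lemma vanishesZ (c : R) u : 0 < c -> vanishes u ->
  vanishes (fun n => c%:E * u n)%E.
Proof.
move=> c0 hu e e0; have [N hN] := hu (e / c) (divr_gt0 e0 c0).
exists N => n /hN; rewrite -(@lte_pmul2l _ c%:E)// -EFinM.
by rewrite mulrCA divff ?gt_eqF// mulr1.
Qed.

Lemma vanishes_le u v : (forall n, (u n <= v n)%E) -> vanishes v -> vanishes u.
Proof.
move=> uv hv e e0; have [N hN] := hv e e0.
by exists N => n /hN; exact: le_lt_trans.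
Qed.

(** The order of choices matters, as [C] depends on the parameter: the parameter is fixed so that
    its term is at most half the tolerance, and only then is [n] taken large enough for the
    remainder. *)
Lemma vanishes_interp (M e0 : R) (N : nat) u r : 0 < e0 -> vanishes r ->
  (forall e, 0 < e -> e <= e0 -> exists C, 0 < C /\
    forall n, (N <= n)%N -> (u n <= (e * M)%:E + C%:E * r n)%E) ->
  vanishes u.
Proof.
(* [M] may be zero or negative; [M1] is a positive bound for it by which one can divide. *)
move=> e00 hr h e ep; pose M1 := `|M| + 1.
have M10 : 0 < M1 by rewrite ltr_pwDr.
pose d := Num.min e0 (e / (2 * M1)).
have d0 : 0 < d by rewrite lt_min e00 divr_gt0// mulr_gt0.
have dM : d * M <= e / 2.
  apply: (@le_trans _ _ (d * M1)).
    by rewrite ler_wpM2l ?(ltW d0)// (le_trans (ler_norm _))// lerDl.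
  apply: (@le_trans _ _ (e / (2 * M1) * M1)).
    by rewrite ler_wpM2r ?(ltW M10)// ge_min lexx orbT.
  by rewrite le_eqVlt; apply/orP; left; apply/eqP; field; rewrite gt_eqF.
have [|C [C0 hC]] := h d d0; first by rewrite ge_min lexx.
have [N1 hN1] := vanishesZ C0 hr (divr_gt0 ep (ltr0Sn R 1)).
exists (maxn N N1) => n; rewrite geq_max => /andP[Nn N1n].
apply: le_lt_trans (hC _ Nn) _.
by rewrite [e in ltRHS]splitr EFinD lee_ltD ?lee_fin ?hN1.
Qed.

End Vanishing.

(** From some index [N] on, each term is within squared distance 1 of the [N]-th, whose norm is
    finite because it is bounded on a domain of finite measure. *)
Lemma L2_cauchy_bounded (R : realType) (Rad L : R) (h : nat -> fn3 R) :
  0 < Rad -> 0 < L ->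
  (forall n, bmeas (XL Rad L) (unc (h n))) ->
  L2_cauchy Rad L h -> exists M N, forall n, (N <= n)%N ->
    (L2sq Rad L (h n) <= M%:E)%E.
Proof.
move=> hRad hL bh ch; have [N hN] := ch 1 ltr01.
have fin := L2sq_fin hRad hL (bh N).
exists (2 + 2 * fine (L2sq Rad L (h N))), N => n Nn.
apply: le_trans (L2sq_le_sub (bh n).1 (bh N).1) _.
have finN : L2sq Rad L (h N) \is a fin_num by rewrite ge0_fin_numE// L2sq_ge0.
rewrite [leRHS](EFinD 2) (EFinM 2) fineK// leeD//.
rewrite -[leRHS]mule1 lee_wpmul2l ?lee_fin//.
exact: ltW (hN n N Nn (leqnn N)).
Qed.

Lemma L2_conv_cauchy (R : realType) (Rad L : R) (h : nat -> fn3 R) (l : fn3 R) :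
  (forall n, mXL Rad L (h n)) -> mXL Rad L l ->
  L2_conv Rad L h l -> L2_cauchy Rad L h.
Proof.
move=> mh ml hl e e0; have e4 : 0 < e / 4 by rewrite divr_gt0.
have [N hN] := hl _ e4; exists N => m n Nm Nn.
apply: le_lt_trans (L2sq_sub_le (mh m) (mh n) ml) _.
have -> : e = 2 * (e / 4) + 2 * (e / 4) by field.
rewrite [ltRHS](EFinD (2 * _)) !(EFinM 2); apply: lteD.
  by rewrite lte_pmul2l ?lte_fin//; exact: hN.
by rewrite lte_pmul2l ?lte_fin//; exact: hN.
Qed.

Theorem theorem3p1 (R : realType) (Rad : R) (hRad : 0 < Rad)
  (V : R -> R) (hV : smooth1 V) (cV : R) (hcV : 0 < cV)
  (hV1 : forall t : R, - cV ^+ 2 <= t * derive1 V t)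
  (hV2 : forall t : R, - cV ^+ 2 <= derive1 (derive1 V) t) :
  exists L0 : R, 0 < L0 /\
    forall (L : R), 0 < L -> L < L0 ->
    forall phi : fn3 R,
      in_H20 Rad L phi ->
      (* Delta phi - V'(phi) = 0 on X_L: the L^2-limit of Delta f_n is V'(phi) *)
      (exists f : nat -> fn3 R, H20_approx Rad L phi f /\
         L2_conv Rad L (fun n => lap (f n)) (fun a b c => derive1 V (phi a b c))) ->
      (* conclusion: d_z phi = 0, i.e. d_z f_n -> 0 in L^2 for every approximating sequence *)
      forall f : nat -> fn3 R, H20_approx Rad L phi f ->
        L2_conv Rad L (fun n => pds [:: 2%N] (f n)) (fun _ _ _ => 0).
Proof.
exists cV^-1; split; first by rewrite invr_gt0.
move=> L hL LcV phi [mphi _] [g [[tg [cg g_phi]] lap_g]] f [tf [cf f_phi]].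
have cL : cV ^+ 2 * L ^+ 2 <= 1.
  rewrite -exprMn exprn_ile1 ?mulr_ge0 ?ltW//.
  by rewrite mulrC -ltr_pdivlMr// div1r.
have mU := mXL_dV hV mphi.
have bpds (h : nat -> fn3 R) s : (forall n, test_fn Rad L (h n)) -> forall n,
    bmeas (XL Rad L) (unc (pds s (h n))).
  by move=> th n; apply: bmeas_XL => //; have [] := th n.
have blap n : bmeas (XL Rad L) (unc (lap (g n))).
  by apply: bmeas_lap => //; have [] := tg n.
(* Convergence makes the Laplacians Cauchy, hence bounded from [N] on; this bound multiplies [e] in
   the energy estimate. *)
have [M [N hM]] := L2_cauchy_bounded hRad hL blap
  (L2_conv_cauchy (fun n => (blap n).1) mU lap_g).
have gz : vanishes (fun n => L2sq Rad L (pds [:: 2%N] (g n))).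
  pose q := (cV ^+ 2 + 1) * L ^+ 2.
  have q0 : 0 < q by rewrite mulr_gt0 ?exprn_gt0// ltr_pwDr// sqr_ge0.
  (* The range [e <= 1 / (2 * q)] is exactly the smallness condition [eL] of the energy estimate. *)
  apply: (@vanishes_interp _ (8 * M) (1 / (2 * q)) N _ (fun n =>
    L2sq Rad L (sub3 (lap (g n)) (fun a b c => derive1 V (phi a b c))) +
    L2sq Rad L (sub3 (g n) phi))%E).
  - by rewrite divr_gt0// mulr_gt0.
  - exact: vanishesD.
  move=> e e0; rewrite (ler_pdivlMr _ _ (mulr_gt0 (ltr0Sn R 1) q0)) => eq.
  have ek : e * e^-1 = 1 by rewrite divff// gt_eqF.
  have eL : e * (cV ^+ 2 + 1) * L ^+ 2 <= 1 / 2.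
    by rewrite -mulrA -/q; move: eq; lra.
  exists (8 * (cV ^+ 2 * (1 + e^-1) + e^-1 + 1)); split.
    rewrite mulr_gt0// addr_gt0// ltr_pwDr ?invr_gt0//.
    by rewrite mulr_ge0 ?sqr_ge0// addr_ge0// invr_ge0 ltW.
  move=> n Nn.
  apply: le_trans (energy_estimate hRad hL cL hV hV2 mphi (tg n) e0 ek eL) _.
  rewrite leeD2r// mulrCA mulrA (EFinM _ M); apply: lee_wpmul2l; last exact: hM.
  by rewrite lee_fin mulr_ge0// ltW.
(* Both sequences converge to [phi] in L^2, so their difference tends to zero. *)
have fg : vanishes (fun n => L2sq Rad L (sub3 (pds [::] (f n)) (pds [::] (g n)))).
  apply: (@vanishes_le _ _ (fun n => 2%:E * L2sq Rad L (sub3 (f n) phi) +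
    2%:E * L2sq Rad L (sub3 (g n) phi))%E).
    move=> n.
    exact: L2sq_sub_le (bpds f [::] tf n).1 (bpds g [::] tg n).1 mphi.
  by apply: vanishesD; apply: vanishesZ.
have [Mf [Nf hMf]] := L2_cauchy_bounded hRad hL (bpds f [:: 2%N; 2%N] tf)
  (cf [:: 2%N; 2%N] isT).
have [Mg [Ng hMg]] := L2_cauchy_bounded hRad hL (bpds g [:: 2%N; 2%N] tg)
  (cg [:: 2%N; 2%N] isT).
have fgz : vanishes (fun n =>
    L2sq Rad L (sub3 (pds [:: 2%N] (f n)) (pds [:: 2%N] (g n)))).
  (* The second z-derivatives of both sequences are Cauchy, hence eventually bounded by [Mf] and
     [Mg]; the squared norm of their difference is at most [2 * Mf + 2 * Mg]. *)
  apply: (vanishes_interp (M := 2 * Mf + 2 * Mg) (N := maxn Nf Ng) ltr01 fg).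
  move=> e e0 _; exists e^-1; split; first by rewrite invr_gt0.
  move=> n; rewrite geq_max => /andP[Nfn Ngn].
  have ek : e * e^-1 = 1 by rewrite divff// gt_eqF.
  apply: le_trans (derive_z_interp hRad hL (tf n) (tg n) e0 ek) _.
  rewrite addeC leeD2r// EFinM; apply: lee_wpmul2l; first by rewrite lee_fin ltW.
  apply: (@le_trans _ _ (2%:E * L2sq Rad L (pds [:: 2%N; 2%N] (f n)) +
    2%:E * L2sq Rad L (pds [:: 2%N; 2%N] (g n)))%E).
    apply: L2sq_le2 => //.
    - exact: mXL_sub (bpds f _ tf n).1 (bpds g _ tg n).1.
    - exact: (bpds f _ tf n).1.
    - exact: (bpds g _ tg n).1.
    move=> x y z; rewrite /sub3; move: (pds _ _ _ _ _) (pds _ _ _ _ _) => s t.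
    by rewrite -subr_ge0 (_ : _ - _ = (s + t) ^+ 2) ?sqr_ge0//; ring.
  rewrite [leRHS](EFinD (2 * _)) !(EFinM 2) leeD// lee_wpmul2l ?lee_fin//; [exact: hMf|exact: hMg].
apply: (@vanishes_le _ _ (fun n =>
  2%:E * L2sq Rad L (sub3 (pds [:: 2%N] (f n)) (pds [:: 2%N] (g n))) +
  2%:E * L2sq Rad L (pds [:: 2%N] (g n)))%E).
  move=> n; rewrite (_ : (fun _ _ _ => _) = pds [:: 2%N] (f n)); last first.
    by apply/funext => a; apply/funext => b; apply/funext => z; rewrite subr0.
  exact: L2sq_le_sub (bpds f _ tf n).1 (bpds g _ tg n).1.
by apply: vanishesD; apply: vanishesZ.
Qed.
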